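(* Let $(V,Q)$ be a non-degenerate quaternary quadratic space over $\mathbb Q$ and let $\mathbb K$ be a field of characteristic $0$. The map $$\mathcal K\colon \mathcal V^{nd}(\mathbb K)\to\mathcal Q(\mathbb K),\qquad v_1\wedge v_2\mapsto [v_1,v_2]=v_1v_2-v_2v_1$$ (products in the Clifford algebra of $(V\otimes\mathbb K,Q)$) is a well-defined bijection and is equivariant with respect to the actions of $S\Gamma_Q(\mathbb K)$ on both sides. Moreover, if $v_3\wedge v_4\in\mathcal V^{nd}(\mathbb K)$ is orthogonal to $v_1\wedge v_2\in\mathcal V^{nd}(\mathbb K)$, then $\mathcal K(v_3\wedge v_4)=z\,\mathcal K(v_1\wedge v_2)$ for some non-zero traceless element $z$ of the center of the even Clifford algebra of $(V\otimes\mathbb K,Q)$.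
   Context: Let $V(\mathbb K)=V\otimes_{\mathbb Q}\mathbb K$, $Q$ extended to $V(\mathbb K)$, $b(x,y)=Q(x+y)-Q(x)-Q(y)$. The Clifford algebra $\mathrm{Cl}$ of $(V(\mathbb K),Q)$ is the quotient of the tensor algebra by the relations $x^2=Q(x)$, with even part $\mathrm{Cl}^0$; $V(\mathbb K)\subset\mathrm{Cl}$. The standard involution $\sigma$ on $\mathrm{Cl}$ is the linear anti-automorphism with $\sigma(v_1\cdots v_m)=(-v_m)\cdots(-v_1)$ for $v_j\in V(\mathbb K)$, and $N(\alpha)=\alpha\sigma(\alpha)$. The special Clifford group is $S\Gamma_Q(\mathbb K)=\{\alpha\in(\mathrm{Cl}^0)^\times:\alpha V(\mathbb K)\alpha^{-1}\subset V(\mathbb K)\}$; it acts on $V(\mathbb K)$ and on $\mathrm{Cl}$ by conjugation $\mathrm{Ad}_\alpha$, and on wedges by $\mathrm{Ad}_\alpha(v_1\wedge v_2)=\mathrm{Ad}_\alpha(v_1)\wedge\mathrm{Ad}_\alpha(v_2)$. The discriminant of a pure wedge is $\mathrm{disc}(v_1\wedge v_2)=Q(v_1)Q(v_2)-\tfrac14b(v_1,v_2)^2$. $\mathcal V^{nd}(\mathbb K)$ is the set of pure wedges $v_1\wedge v_2\in\bigwedge^2V(\mathbb K)$ with $\mathrm{disc}(v_1\wedge v_2)\ne0$. Two elements $v_1\wedge v_2,v_3\wedge v_4$ of $\mathcal V^{nd}(\mathbb K)$ are orthogonal if the planes spanned by $v_1,v_2$ and by $v_3,v_4$ are orthogonal.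 Define $\mathcal Q(\mathbb K)=\{\alpha\in(\mathrm{Cl}^0)^\times:\sigma(\alpha)=-\alpha,\ N(\alpha)\in\mathbb K^\times\}$, on which $S\Gamma_Q(\mathbb K)$ acts by conjugation. The center of $\mathrm{Cl}^0$ is the quadratic $\mathbb K$-algebra with basis $1,\,e_1e_2e_3e_4$ for any orthogonal basis $(e_j)$ of $V(\mathbb K)$; ''traceless'' means trace zero over $\mathbb K$, i.e. a $\mathbb K$-multiple of $e_1e_2e_3e_4$. *)

(* Defs.v *)
From HB Require Import structures.
From mathcomp Require Import all_boot all_order all_algebra.
From mathcomp Require Import generic_quotient finmap ring.
From mathcomp Require Import boolp classical_sets functions.
From mathcomp.multinomials Require Import monalg.

Set Implicit Arguments.
Unset Strict Implicit.
Unset Printing Implicit Defensive.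

Import GRing.Theory.

Local Open Scope ring_scope.
Local Open Scope quotient_scope.

Section QuadraticForms.
Variables (K : fieldType) (W : lmodType K).

Definition polar (q : W -> K) (x y : W) : K := q (x + y) - q x - q y.

Record quad_form := QuadForm {
  quad_fun :> W -> K;
  quadZ : forall a x, quad_fun (a *: x) = a ^+ 2 * quad_fun x;
  polarP : forall a x y z,
    polar quad_fun (a *: x + y) z = a * polar quad_fun x z + polar quad_fun y z
}.

Definition quad_nondegenerate (q : quad_form) : Prop :=
  forall x, (forall y, polar q x y = 0) -> x = 0.

Lemma zero_quadZ a (x : W) : (fun=> 0 : K) (a *: x) = a ^+ 2 * 0.
Proof. by rewrite mulr0. Qed.

Lemma zero_polarP a (x y z : W) :
  polar (fun=> 0 : K) (a *: x + y) z = a * polar (fun=> 0) x z + polar (fun=> 0) y z.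
Proof. by rewrite /polar !subrr mulr0 addr0. Qed.

Definition zero_quad : quad_form := QuadForm zero_quadZ zero_polarP.

Variable q : quad_form.

Lemma polarC x y : polar q x y = polar q y x.
Proof. by rewrite /polar [y + x]addrC addrAC. Qed.

Lemma polarDl x y z : polar q (x + y) z = polar q x z + polar q y z.
Proof. by have := polarP q 1 x y z; rewrite scale1r mul1r. Qed.

Lemma polar0l z : polar q 0 z = 0.
Proof. by apply: (addrI (polar q 0 z)); rewrite -polarDl !addr0. Qed.

Lemma polarZl a x z : polar q (a *: x) z = a * polar q x z.
Proof. by have := polarP q a x 0 z; rewrite polar0l !addr0. Qed.

Lemma polar0r z : polar q z 0 = 0.
Proof. by rewrite polarC polar0l. Qed.

Lemma polarDr x y z : polar q z (x + y) = polar q z x + polar q z y.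
Proof. by rewrite ![polar q z _]polarC polarDl. Qed.

Lemma polarZr a x z : polar q z (a *: x) = a * polar q z x.
Proof. by rewrite ![polar q z _]polarC polarZl. Qed.

Lemma polar_sumr (I : Type) (r : seq I) (P : pred I) (F : I -> W) z :
  polar q z (\sum_(i <- r | P i) F i) = \sum_(i <- r | P i) polar q z (F i).
Proof. exact: (big_morph _ (fun x y => polarDr x y z) (polar0r z)). Qed.

Lemma quadD x y : q (x + y) = q x + q y + polar q x y.
Proof. by rewrite /polar -[_ - q x - q y]addrA -opprD [RHS]addrC subrK. Qed.

Lemma quad0 : q 0 = 0.
Proof. by rewrite -(scale0r 0) quadZ expr0n mul0r. Qed.

End QuadraticForms.

(* Matrices e_i with (sum_i x_i e_i)^2 = q (sum_i x_i w_i): they show that no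
   Clifford algebra collapses to the zero ring. *)
Lemma clifford_matrices (K : fieldType) (W : lmodType K) (q : quad_form W)
    (m : nat) (w : 'I_m -> W) :
  exists N, exists2 f : 'I_m -> 'M[K]_N, (0 < N)%N & forall x : 'I_m -> K,
    (\sum_i x i *: f i) *m (\sum_i x i *: f i) = (q (\sum_i x i *: w i))%:M.
Proof.
elim: m w => [|m IH] w.
  exists 1%N; exists (fun=> 0) => // x.
  by rewrite !big_ord0 mulmx0 quad0 raddf0.
have [N [f N0 fP]] := IH (fun i => w (lift ord0 i)).
pose g (i : 'I_m) : 'M[K]_(N + N) :=
  block_mx (f i) (polar q (w ord0) (w (lift ord0 i)))%:M 0 (- f i).
pose g0 : 'M[K]_(N + N) := block_mx 0 (q (w ord0))%:M 1%:M 0.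
exists (N + N)%N.
exists (fun i : 'I_m.+1 => if unlift ord0 i is Some j then g j else g0) => [|x].
  by rewrite addn_gt0 N0.
have -> : \sum_(i < m.+1) x i *: (if unlift ord0 i is Some j then g j else g0)
        = x ord0 *: g0 + \sum_i x (lift ord0 i) *: g i.
  rewrite big_ord_recl unlift_none; congr (_ + _).
  by apply: eq_bigr => i _; rewrite liftK.
rewrite big_ord_recl.
set F := \sum_i x (lift ord0 i) *: f i.
set y := \sum_i x (lift ord0 i) *: w (lift ord0 i).
have -> : \sum_i x (lift ord0 i) *: g i
        = block_mx F (polar q (w ord0) y)%:M 0 (- F).
  rewrite /F /y polar_sumr.
  elim/big_rec3: _ => [|i A B C _ ->].
    by rewrite raddf0 oppr0 block_mx0.
  rewrite /g scale_block_mx add_block_mx scaler0 addr0 opprD scalerN.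
  by rewrite polarZr scale_scalar_mx -raddfD.
rewrite /g0 scale_block_mx add_block_mx !scaler0 !add0r !scale_scalar_mx mulr1.
rewrite addr0 mulmx_block !mulmxN !mulNmx opprK.
rewrite fP quadD quadZ polarZl -!raddfD /=.
have cF (a : K) : a%:M *m F = F *m a%:M by rewrite scalar_mxC.
rewrite !cF !addrN -/y -!scalar_mxM -!raddfD /= scalar_mx_block.
congr block_mx; congr _%:M.
  by rewrite mulrDl expr2 mulrAC [polar q _ _ * _]mulrC addrA [q y + _]addrC.
by rewrite mulrDr expr2 mulrA addrAC.
Qed.

(* The tensor algebra of [W], realised as the free associative algebra on the
   coordinate basis of [W] (see [tensor_lift_in] and [tensor_lift_unique]). *)
Section TensorAlgebra.
Variables (K : fieldType) (W : vectType K).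

Definition tensor_alg := {malg K[{fmonom 'I_(\dim {:W})}]}.

HB.instance Definition _ := GRing.Lalgebra.on tensor_alg.

Definition tensor_in (x : W) : tensor_alg :=
  \sum_i << coord (vbasis {:W}) i x *g fmu i >>.

Definition vbase (i : 'I_(\dim {:W})) : W := (vbasis {:W})`_i.

Lemma vbase_sum x : x = \sum_i coord (vbasis {:W}) i x *: vbase i.
Proof. by apply: coord_vbasis; rewrite memvf. Qed.

Lemma coord_vbase i j : coord (vbasis {:W}) i (vbase j) = (i == j)%:R.
Proof. by rewrite coord_free ?(basis_free (vbasisP _)) // eq_sym. Qed.

Lemma tensorZU c k m : c *: (<< k *g m >> : tensor_alg) = << c * k *g m >>.
Proof. by apply/malgP => n; rewrite [LHS](mcoeffZ c) [in LHS]mcoeffU [RHS]mcoeffU mulrnAr. Qed.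

Lemma tensorZAr c (s t : tensor_alg) : c *: (s * t) = s * (c *: t).
Proof.
rewrite !malgME scaler_sumr.
transitivity (\sum_(k1 <- msupp s) \sum_(k2 <- msupp t)
    << s@_k1 * (c *: t)@_k2 *g mmul k1 k2 >> : tensor_alg).
  apply: eq_bigr => k1 _; rewrite scaler_sumr; apply: eq_bigr => k2 _.
  by rewrite tensorZU mcoeffZ mulrCA.
by rewrite -(malgMEw (fsubset_refl _) (msuppZ_le _ _)) malgME.
Qed.

Lemma tensor_in_is_linear : linear tensor_in.
Proof.
move=> a x y; rewrite /tensor_in scaler_sumr -big_split /=.
apply: eq_bigr => i _.
by rewrite linearP /= tensorZU monalgUD.
Qed.

HB.instance Definition _ :=
  GRing.isLinear.Build K W tensor_alg _ tensor_in tensor_in_is_linear.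

Lemma tensor_in_vbase i : tensor_in (vbase i) = << fmu i >>.
Proof.
rewrite /tensor_in (bigD1 i) //= big1 => [|j ji].
  by rewrite coord_vbase eqxx addr0.
by rewrite coord_vbase (negbTE ji) monalgU0.
Qed.

Lemma tensor_wordE (m : {fmonom 'I_(\dim {:W})}) :
  << m >> = \prod_(i <- m) tensor_in (vbase i) :> tensor_alg.
Proof.
case: m => s /=; elim: s => [|i s IH].
  by rewrite big_nil -[RHS]/(<< mone >>) /mone /= fmoneE.
rewrite big_cons -IH tensor_in_vbase [RHS]fgmulUU mulr1; congr << _ *g _ >>.
by apply: val_inj; rewrite /= fmM fmU.
Qed.

Lemma tensor_span (t : tensor_alg) :
  t = \sum_(m <- msupp t) t@_m *: \prod_(i <- m) tensor_in (vbase i).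
Proof.
rewrite [LHS]monalgE; apply: eq_bigr => m _.
by rewrite -tensor_wordE tensorZU mulr1.
Qed.

Section Lift.
Variables (A : algType K) (f : {linear W -> A}).

Let word (m : {fmonom 'I_(\dim {:W})}) : A := \prod_(i <- m) f (vbase i).

Let word_mmorphism : mmorphism word.
Proof. by split=> [m1 m2|]; rewrite /word ?fmM ?big_cat // fm1 big_nil. Qed.

HB.instance Definition _ := isMultiplicative.Build _ _ word word_mmorphism.

Definition tensor_lift (t : tensor_alg) : A := mmap (in_alg A) word t.

Lemma tensor_lift_is_linear : linear tensor_lift.
Proof.
move=> a s t; rewrite /tensor_lift raddfD /=; congr (_ + _).
by rewrite mmapZ /= mulr_algl.
Qed.

HB.instance Definition _ :=
  GRing.isLinear.Build K tensor_alg A _ tensor_lift tensor_lift_is_linear.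

Lemma tensor_lift_is_monoid_morphism : monoid_morphism tensor_lift.
Proof.
have [hM h1] : multiplicative tensor_lift.
  apply: commr_mmap_is_multiplicative => g m m'.
  by rewrite /GRing.comm /= mulr_algl mulr_algr.
by split.
Qed.

HB.instance Definition _ := GRing.isMonoidMorphism.Build tensor_alg A tensor_lift
  tensor_lift_is_monoid_morphism.

Lemma tensor_lift_in x : tensor_lift (tensor_in x) = f x.
Proof.
rewrite {2}[x]vbase_sum !linear_sum /=; apply: eq_bigr => i _.
by rewrite /tensor_lift mmapU /= mulr_algl linearZ /word fmU big_seq1.
Qed.

Lemma tensor_lift_unique (g : tensor_alg -> A) :
  linear g -> monoid_morphism g -> (forall x, g (tensor_in x) = f x) ->
  g =1 tensor_lift.
Proof.
move=> gL gM gf t.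
have g0 : g 0 = 0.
  have := gL (-1) 0 0; rewrite scaler0 addr0 => ->.
  by rewrite scaleN1r addNr.
have gS : g t = \sum_(m <- msupp t)
    t@_m *: g (\prod_(i <- m) tensor_in (vbase i)).
  rewrite {1}[t]tensor_span; elim: (msupp t : seq _) => [|m s IH].
    by rewrite !big_nil.
  by rewrite !big_cons gL IH.
rewrite gS [in RHS](tensor_span t) linear_sum; apply: eq_bigr => m _.
rewrite [RHS]linearZ; congr (_ *: _).
rewrite rmorph_prod (big_morph g gM.2 gM.1).
by apply: eq_bigr => i _; rewrite gf -[LHS]tensor_lift_in.
Qed.

End Lift.

(* The linear anti-automorphism x_1 ... x_m |-> (- x_m) ... (- x_1). *)
Definition tensor_inv (t : tensor_alg) : tensor_alg :=
  \sum_(m <- msupp t) t@_m *: \prod_(i <- rev m) - tensor_in (vbase i).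

Lemma tensor_invE (d : {fset {fmonom 'I_(\dim {:W})}}) t : (msupp t `<=` d)%fset ->
  tensor_inv t = \sum_(m <- d) t@_m *: \prod_(i <- rev m) - tensor_in (vbase i).
Proof.
move=> le_d; rewrite /tensor_inv (big_fset_incl _ le_d) // => m _ /mcoeff_outdom ->.
by rewrite scale0r.
Qed.

Lemma tensor_inv_is_linear : linear tensor_inv.
Proof.
move=> a s t; pose d := (msupp (a *: s + t) `|` (msupp s `|` msupp t))%fset.
have [d1 d2 d3] : [/\ msupp (a *: s + t) `<=` d, msupp s `<=` d & msupp t `<=` d]%fset.
  split; first exact: fsubsetUl.
  - by rewrite /d fsetUCA fsubsetUl.
  - by rewrite /d fsetUA fsubsetUr.
rewrite (tensor_invE d1) (tensor_invE d2) (tensor_invE d3).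
rewrite scaler_sumr -big_split /=; apply: eq_bigr => m _.
by rewrite (mcoeffD m (a *: s) t) (mcoeffZ a s m) scalerDl scalerA.
Qed.

HB.instance Definition _ :=
  GRing.isLinear.Build K tensor_alg tensor_alg _ tensor_inv tensor_inv_is_linear.

Lemma tensor_invU c m : tensor_inv << c *g m >> =
  c *: \prod_(i <- rev m) - tensor_in (vbase i).
Proof. by rewrite (tensor_invE msuppU_le) big_seq_fset1 mcoeffUU. Qed.

Lemma tensor_inv1 : tensor_inv 1 = 1.
Proof. by rewrite tensor_invU fm1 big_nil scale1r. Qed.

Lemma tensor_inv_in x : tensor_inv (tensor_in x) = - tensor_in x.
Proof.
rewrite /tensor_in !linear_sum /=; apply: eq_bigr => i _.
by rewrite tensor_invU fmU big_seq1 tensor_in_vbase scalerN tensorZU mulr1.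
Qed.

Lemma tensor_invM s t : tensor_inv (s * t) = tensor_inv t * tensor_inv s.
Proof.
rewrite [in RHS](monalgE s) [in RHS](monalgE t) malgME.
rewrite [LHS]linear_sum [tensor_inv (\sum_(_ <- msupp s) _)]linear_sum.
rewrite [tensor_inv (\sum_(_ <- _) _)]linear_sum /= mulr_sumr.
apply: eq_bigr => i _; rewrite linear_sum mulr_suml /=.
apply: eq_bigr => j _; rewrite !tensor_invU fmM rev_cat big_cat /=.
by rewrite -scalerAl -tensorZAr scalerA mulrC.
Qed.

End TensorAlgebra.

Section TwoSidedIdeal.
Variables (A : nzRingType) (S : A -> Prop).

Inductive ideal_gen : A -> Prop :=
| ideal_gen_in x : S x -> ideal_gen x
| ideal_gen0 : ideal_gen 0
| ideal_genD x y : ideal_gen x -> ideal_gen y -> ideal_gen (x + y)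
| ideal_genMl a x : ideal_gen x -> ideal_gen (a * x)
| ideal_genMr a x : ideal_gen x -> ideal_gen (x * a).

Lemma ideal_genN x : ideal_gen x -> ideal_gen (- x).
Proof. by move=> ?; rewrite -mulN1r; apply: ideal_genMl. Qed.

Lemma ideal_genB x y : ideal_gen x -> ideal_gen y -> ideal_gen (x - y).
Proof. by move=> ? ?; apply: ideal_genD => //; apply: ideal_genN. Qed.

End TwoSidedIdeal.

Section Clifford.
Variables (K : fieldType) (W : vectType K) (q : quad_form W).

Local Notation T := (tensor_alg W).

Definition clifford_rel (t : T) : Prop :=
  exists x : W, t = tensor_in x * tensor_in x - (q x)%:A.

Definition clifford_eq (s t : T) : bool :=
  `[< ideal_gen clifford_rel (s - t) >].

Lemma clifford_eq_refl : reflexive clifford_eq.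
Proof. by move=> t; apply/asboolP; rewrite subrr; apply: ideal_gen0. Qed.

Lemma clifford_eq_sym : symmetric clifford_eq.
Proof.
by move=> s t; apply/asboolP/asboolP => /ideal_genN; rewrite opprB.
Qed.

Lemma clifford_eq_trans : transitive clifford_eq.
Proof.
move=> t s u /asboolP st /asboolP tu; apply/asboolP.
by have := ideal_genD st tu; rewrite addrA subrK.
Qed.

Canonical clifford_equiv :=
  EquivRel clifford_eq clifford_eq_refl clifford_eq_sym clifford_eq_trans.

Definition clifford := {eq_quot clifford_equiv}.

HB.instance Definition _ := Choice.on clifford.
HB.instance Definition _ := Quotient.on clifford.

Local Notation pi := (\pi_clifford).

Lemma clifford_piP s t : pi s = pi t <-> ideal_gen clifford_rel (s - t).
Proof.
split=> [/eqmodP/asboolP //|st].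
by apply/eqmodP/asboolP.
Qed.

Lemma clifford_reprB t : ideal_gen clifford_rel (repr (pi t) - t).
Proof. by apply/clifford_piP; rewrite reprK. Qed.

Lemma clifford_piW (P : clifford -> Prop) : (forall t, P (pi t)) -> forall a, P a.
Proof. by move=> h a; rewrite -[a]reprK. Qed.

Definition clifford_zero : clifford := pi 0.
Definition clifford_one : clifford := pi 1.
Definition clifford_opp (a : clifford) : clifford := pi (- repr a).
Definition clifford_add (a b : clifford) : clifford := pi (repr a + repr b).
Definition clifford_mul (a b : clifford) : clifford := pi (repr a * repr b).
Definition clifford_scale (c : K) (a : clifford) : clifford := pi (c *: repr a).

Lemma clifford_piN t : clifford_opp (pi t) = pi (- t).
Proof.
by apply/clifford_piP; rewrite -opprD; apply/ideal_genN/clifford_reprB.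
Qed.

Lemma clifford_piD s t : clifford_add (pi s) (pi t) = pi (s + t).
Proof.
apply/clifford_piP; rewrite opprD addrACA.
by apply: ideal_genD; apply: clifford_reprB.
Qed.

Lemma clifford_piM s t : clifford_mul (pi s) (pi t) = pi (s * t).
Proof.
apply/clifford_piP; set s' := repr _; set t' := repr _.
have -> : s' * t' - s * t = (s' - s) * t' + s * (t' - t).
  by rewrite mulrBl mulrBr addrA subrK.
by apply: ideal_genD; [apply: ideal_genMr|apply: ideal_genMl];
  apply: clifford_reprB.
Qed.

Lemma clifford_piZ c t : clifford_scale c (pi t) = pi (c *: t).
Proof.
apply/clifford_piP; rewrite -scalerBr -mulr_algl.
by apply: ideal_genMl; apply: clifford_reprB.
Qed.

Let piE := (clifford_piN, clifford_piD, clifford_piM, clifford_piZ).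

Lemma clifford_addA : associative clifford_add.
Proof.
by do 3![elim/clifford_piW=> ?]; rewrite !piE addrA.
Qed.

Lemma clifford_addC : commutative clifford_add.
Proof. by do 2![elim/clifford_piW=> ?]; rewrite !piE addrC. Qed.

Lemma clifford_add0 : left_id clifford_zero clifford_add.
Proof. by elim/clifford_piW=> ?; rewrite !piE add0r. Qed.

Lemma clifford_addN : left_inverse clifford_zero clifford_opp clifford_add.
Proof. by elim/clifford_piW=> ?; rewrite !piE addNr. Qed.

HB.instance Definition _ := GRing.isZmodule.Build clifford
  clifford_addA clifford_addC clifford_add0 clifford_addN.

Lemma clifford_mulA : associative clifford_mul.
Proof. by do 3![elim/clifford_piW=> ?]; rewrite !piE mulrA. Qed.

Lemma clifford_mul1l : left_id clifford_one clifford_mul.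
Proof. by elim/clifford_piW=> ?; rewrite !piE mul1r. Qed.

Lemma clifford_mul1r : right_id clifford_one clifford_mul.
Proof. by elim/clifford_piW=> ?; rewrite !piE mulr1. Qed.

Lemma clifford_mulDl : left_distributive clifford_mul +%R.
Proof.
by do 3![elim/clifford_piW=> ?]; rewrite -![_ + _]/(clifford_add _ _) !piE mulrDl.
Qed.

Lemma clifford_mulDr : right_distributive clifford_mul +%R.
Proof.
by do 3![elim/clifford_piW=> ?]; rewrite -![_ + _]/(clifford_add _ _) !piE mulrDr.
Qed.

Lemma ideal_gen_lift (A : algType K) (f : {linear W -> A}) (t : T) :
  (forall x, f x * f x = (q x)%:A) ->
  ideal_gen clifford_rel t -> tensor_lift f t = 0.
Proof.
move=> fq; elim=> {t} [t [x ->]||s t _ hs _ ht|a t _ ht|a t _ ht].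
- by rewrite rmorphB rmorphM /= linearZ rmorph1 tensor_lift_in fq subrr.
- by rewrite rmorph0.
- by rewrite rmorphD /= hs ht addr0.
- by rewrite rmorphM /= ht mulr0.
- by rewrite rmorphM /= ht mul0r.
Qed.

Lemma clifford_oner_neq0 : clifford_one != 0.
Proof.
apply/eqP => /clifford_piP; rewrite subr0 => id1.
have [[|N] [f // _ fP]] := clifford_matrices q (@vbase K W).
pose g (x : W) : 'M[K]_N.+1 := \sum_i coord (vbasis {:W}) i x *: f i.
have gL : linear g.
  move=> a x y; rewrite /g scaler_sumr -big_split /=.
  by apply: eq_bigr => i _; rewrite linearP scalerDl scalerA.
pose g' : {linear W -> 'M[K]_N.+1} :=
  HB.pack g (GRing.isLinear.Build K W 'M[K]_N.+1 _ g gL).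
have gq x : g' x * g' x = (q x)%:A.
  rewrite scalemx1 {3}[x]vbase_sum -fP //.
have := ideal_gen_lift gq id1.
by rewrite rmorph1 => /eqP; rewrite oner_eq0.
Qed.

HB.instance Definition _ := GRing.Zmodule_isNzRing.Build clifford
  clifford_mulA clifford_mul1l clifford_mul1r clifford_mulDl clifford_mulDr
  clifford_oner_neq0.

Lemma clifford_scaleA a b c :
  clifford_scale a (clifford_scale b c) = clifford_scale (a * b) c.
Proof. by elim/clifford_piW: c => ?; rewrite !piE scalerA. Qed.

Lemma clifford_scale1 : left_id 1 clifford_scale.
Proof. by elim/clifford_piW=> ?; rewrite !piE scale1r. Qed.

Lemma clifford_scaleDr : right_distributive clifford_scale +%R.
Proof.
move=> c; do 2![elim/clifford_piW=> ?].
by rewrite -![_ + _]/(clifford_add _ _) !piE scalerDr.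
Qed.

Lemma clifford_scaleDl a :
  {morph clifford_scale^~ a : b c / b + c >-> b + c}.
Proof.
elim/clifford_piW: a => ? b c.
by rewrite -![_ + _ in RHS]/(clifford_add _ _) !piE scalerDl.
Qed.

HB.instance Definition _ := GRing.Zmodule_isLmodule.Build K clifford
  clifford_scaleA clifford_scale1 clifford_scaleDr clifford_scaleDl.

Lemma clifford_scaleAl c (a b : clifford) : c *: (a * b) = (c *: a) * b.
Proof.
elim/clifford_piW: a => s; elim/clifford_piW: b => t.
by rewrite -![_ * _]/(clifford_mul _ _) -![_ *: _]/(clifford_scale _ _)
  !piE scalerAl.
Qed.

Lemma clifford_scaleAr c (a b : clifford) : c *: (a * b) = a * (c *: b).
Proof.
elim/clifford_piW: a => s; elim/clifford_piW: b => t.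
by rewrite -![_ * _]/(clifford_mul _ _) -![_ *: _]/(clifford_scale _ _)
  !piE tensorZAr.
Qed.

HB.instance Definition _ :=
  GRing.Lmodule_isLalgebra.Build K clifford clifford_scaleAl.
HB.instance Definition _ :=
  GRing.Lalgebra_isAlgebra.Build K clifford clifford_scaleAr.

Definition clifford_unit (a : clifford) : bool :=
  `[< exists b, b * a = 1 /\ a * b = 1 >].

Definition clifford_inv (a : clifford) : clifford :=
  if pselect (exists b, b * a = 1 /\ a * b = 1) is left h
  then projT1 (cid h) else a.

Lemma clifford_mulVr : {in clifford_unit, left_inverse 1 clifford_inv *%R}.
Proof.
move=> a /asboolP ua; rewrite /clifford_inv; case: pselect => // h.
by case: (cid h) => b /= [].
Qed.

Lemma clifford_divrr : {in clifford_unit, right_inverse 1 clifford_inv *%R}.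
Proof.
move=> a /asboolP ua; rewrite /clifford_inv; case: pselect => // h.
by case: (cid h) => b /= [].
Qed.

Lemma clifford_unitP (a b : clifford) :
  b * a = 1 /\ a * b = 1 -> clifford_unit a.
Proof. by move=> h; apply/asboolP; exists b. Qed.

Lemma clifford_inv_out : {in [predC clifford_unit], clifford_inv =1 id}.
Proof.
move=> a /asboolP ua; rewrite /clifford_inv; case: pselect => // h.
Qed.

HB.instance Definition _ := GRing.NzRing_hasMulInverse.Build clifford
  clifford_mulVr clifford_divrr clifford_unitP clifford_inv_out.

Definition clifford_in (x : W) : clifford := pi (tensor_in x).

Lemma clifford_pi_is_linear : linear pi.
Proof. by move=> c s t; rewrite -clifford_piD -clifford_piZ. Qed.

Lemma clifford_pi_is_monoid_morphism : monoid_morphism pi.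
Proof. by split=> [|s t]; [|exact: esym (clifford_piM s t)]. Qed.

Lemma clifford_in_is_linear : linear clifford_in.
Proof. by move=> c x y; rewrite /clifford_in linearP clifford_pi_is_linear. Qed.

HB.instance Definition _ :=
  GRing.isLinear.Build K W clifford _ clifford_in clifford_in_is_linear.

Lemma clifford_in_sqr x : clifford_in x * clifford_in x = (q x)%:A.
Proof.
have -> : (q x)%:A = pi (q x)%:A by rewrite -clifford_piZ.
rewrite -[LHS]clifford_pi_is_monoid_morphism.2.
by apply/clifford_piP/ideal_gen_in; exists x.
Qed.

Lemma clifford_span (a : clifford) : exists s : seq (K * seq W),
  a = \sum_(p <- s) p.1 *: \prod_(x <- p.2) clifford_in x.
Proof.
elim/clifford_piW: a => t.
exists [seq (t@_m, [seq vbase i | i <- (m : seq _)]) | m : {fmonom _} <- msupp t].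
have [piM pi1] := (clifford_pi_is_monoid_morphism.2, clifford_pi_is_monoid_morphism.1).
pose p' : {linear T -> clifford} :=
  HB.pack pi (GRing.isLinear.Build K T clifford _ pi clifford_pi_is_linear).
rewrite big_map {1}[t]tensor_span -[pi _]/(p' _) linear_sum.
apply: eq_bigr => m _; rewrite linearZ /= big_map; congr (_ *: _).
exact: (big_morph pi piM pi1).
Qed.

Lemma clifford_universal (A : algType K) (f : {linear W -> A}) :
  (forall x, f x * f x = (q x)%:A) ->
  exists g : clifford -> A,
    [/\ linear g, monoid_morphism g, forall x, g (clifford_in x) = f x &
      forall h : clifford -> A, linear h -> monoid_morphism h ->
        (forall x, h (clifford_in x) = f x) -> h =1 g].
Proof.
move=> fq; pose g (a : clifford) := tensor_lift f (repr a).
have gpi t : g (pi t) = tensor_lift f t.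
  have := ideal_gen_lift fq (clifford_reprB t).
  by rewrite linearB => /eqP; rewrite subr_eq0 => /eqP.
have gL : linear g.
  move=> c; do 2![elim/clifford_piW=> ?].
  by rewrite -clifford_pi_is_linear !gpi linearP.
have gM : monoid_morphism g.
  split=> [|a b]; first by rewrite gpi rmorph1.
  elim/clifford_piW: a => s; elim/clifford_piW: b => t.
  by rewrite -clifford_pi_is_monoid_morphism.2 !gpi rmorphM.
have gin x : g (clifford_in x) = f x by rewrite gpi tensor_lift_in.
exists g; split; [exact: gL|exact: gM|exact: gin|move=> h hL hM hin a].
have ext (k : clifford -> A) (s : seq (K * seq W)) :
    linear k -> monoid_morphism k -> (forall x, k (clifford_in x) = f x) ->
    k (\sum_(p <- s) p.1 *: \prod_(x <- p.2) clifford_in x) =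
    \sum_(p <- s) p.1 *: \prod_(x <- p.2) f x.
  move=> kL [k1 kM] kin.
  have k0 : k 0 = 0.
    have := kL (-1) 0 0; rewrite scaler0 addr0 => ->.
    by rewrite scaleN1r addNr.
  elim: s => [|p s IH]; first by rewrite !big_nil.
  rewrite !big_cons kL IH (big_morph k kM k1).
  by congr (_ *: _ + _); apply: eq_bigr => x _; rewrite kin.
by have [s ->] := clifford_span a; rewrite !ext.
Qed.

Definition clifford_sigma (a : clifford) : clifford := pi (tensor_inv (repr a)).

Lemma ideal_gen_inv t :
  ideal_gen clifford_rel t -> ideal_gen clifford_rel (tensor_inv t).
Proof.
elim=> {t} [t [x ->]||s t _ hs _ ht|a t _ ht|a t _ ht].
- apply: ideal_gen_in; exists x.
  by rewrite linearB /= tensor_invM tensor_inv_in mulrNN linearZ /= tensor_inv1.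
- by rewrite linear0; apply: ideal_gen0.
- by rewrite [tensor_inv _]linearD; apply: ideal_genD hs ht.
- by rewrite tensor_invM; apply: ideal_genMr.
- by rewrite tensor_invM; apply: ideal_genMl.
Qed.

Lemma clifford_sigma_pi t : clifford_sigma (pi t) = pi (tensor_inv t).
Proof.
by apply/clifford_piP; rewrite -linearB; apply/ideal_gen_inv/clifford_reprB.
Qed.

Lemma clifford_sigma_is_linear : linear clifford_sigma.
Proof.
move=> c; elim/clifford_piW=> s; elim/clifford_piW=> t.
transitivity (clifford_sigma (pi (c *: s + t))).
  by congr clifford_sigma; exact/esym/clifford_pi_is_linear.
rewrite (clifford_sigma_pi s) (clifford_sigma_pi t).
rewrite (clifford_sigma_pi (c *: s + t)) (tensor_inv_is_linear c s t).
exact: clifford_pi_is_linear.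
Qed.

HB.instance Definition _ := GRing.isLinear.Build K clifford clifford _
  clifford_sigma clifford_sigma_is_linear.

Lemma clifford_sigmaM a b :
  clifford_sigma (a * b) = clifford_sigma b * clifford_sigma a.
Proof.
elim/clifford_piW: a => s; elim/clifford_piW: b => t.
rewrite -clifford_pi_is_monoid_morphism.2 !clifford_sigma_pi tensor_invM.
exact: clifford_pi_is_monoid_morphism.2.
Qed.

Lemma clifford_sigma1 : clifford_sigma 1 = 1.
Proof. by rewrite clifford_sigma_pi tensor_inv1. Qed.

Lemma clifford_sigma_prod (s : seq W) :
  clifford_sigma (\prod_(x <- s) clifford_in x) =
  \prod_(x <- rev s) - clifford_in x.
Proof.
elim: s => [|x s IH]; first by rewrite !big_nil clifford_sigma1.
rewrite rev_cons big_cons big_rcons /= clifford_sigmaM IH; congr (_ * _).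
rewrite clifford_sigma_pi tensor_inv_in.
by rewrite -scaleN1r -clifford_piZ -[RHS]scaleN1r.
Qed.

End Clifford.

Section Exterior.
Variables (K : fieldType) (W : vectType K).

(* For the zero form the defining relations are x * x = 0. *)
Definition exterior : unitAlgType K := clifford (zero_quad W).

(* The pure wedge x /\ y, an element of the degree 2 part of the exterior
   algebra. *)
Definition wedge (x y : W) : exterior :=
  clifford_in (zero_quad W) x * clifford_in (zero_quad W) y.

End Exterior.

Section RatrChar0.
Variables (K : fieldType) (charK : [pchar K] =i pred0).

Lemma intr_neq0_char0 (n : int) : n != 0 -> n%:~R != 0 :> K.
Proof.
move=> n0; have : `|n|%N%:R != 0 :> K by rewrite ((pcharf0P K).1 charK) absz_eq0.
by case: n {n0} => n //=; rewrite NegzE mulrNz oppr_eq0.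
Qed.

Lemma ratr_frac_char0 (a b : int) : b != 0 ->
  ratr (a%:~R / b%:~R) = a%:~R / b%:~R :> K.
Proof.
move=> b0; set x := _ / _ : rat; rewrite /ratr.
apply/eqP; rewrite eqr_div ?intr_neq0_char0 ?denq_neq0 //; apply/eqP.
rewrite -!intrM; congr _%:~R; apply: (@intr_inj rat); rewrite !intrM.
by apply/eqP; rewrite -eqr_div ?intr_eq0 ?denq_neq0 // divq_num_den.
Qed.

Lemma ratrD_char0 : {morph @ratr K : x y / x + y}.
Proof.
move=> x y; rewrite -{1}[x]divq_num_den -{1}[y]divq_num_den.
rewrite addf_div ?intr_eq0 ?denq_neq0 // -!intrM -intrD.
rewrite ratr_frac_char0 ?mulf_neq0 ?denq_neq0 //.
by rewrite intrD !intrM -addf_div ?intr_neq0_char0 ?denq_neq0.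
Qed.

Lemma ratrM_char0 : {morph @ratr K : x y / x * y}.
Proof.
move=> x y; rewrite -{1}[x]divq_num_den -{1}[y]divq_num_den.
rewrite mulf_div -!intrM ratr_frac_char0 ?mulf_neq0 ?denq_neq0 //.
by rewrite !intrM -mulf_div.
Qed.

Lemma ratr_sum_char0 (I : Type) (r : seq I) (P : pred I) (F : I -> rat) :
  ratr (\sum_(i <- r | P i) F i) = \sum_(i <- r | P i) ratr (F i) :> K.
Proof. by apply: (big_morph _ ratrD_char0); rewrite -[0]/(0%:~R) ratr_int. Qed.

End RatrChar0.

Section BaseChange.
Variables (V : vectType rat) (K : fieldType).

(* V (x) K, by coordinates in the rational basis [vbase] of V; [ext v] is
   v (x) 1 (see [extension_universal]). *)
Definition extension : vectType K := 'rV[K]_(\dim {:V}).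

Definition ext (v : V) : extension := \row_i ratr (coord (vbasis {:V}) i v).

Lemma ext_vbase i : ext (vbase i) = delta_mx 0 i.
Proof.
apply/rowP => j; rewrite !mxE eqxx /= coord_vbase.
by rewrite -[RHS](ratr_nat K).
Qed.

Lemma extension_universal (U : lmodType K) (f : V -> U) :
  {morph f : v w / v + w} -> (forall a v, f (a *: v) = ratr a *: f v) ->
  exists g : extension -> U,
    [/\ linear g, forall v, g (ext v) = f v &
      forall h : extension -> U,
        linear h -> (forall v, h (ext v) = f v) -> h =1 g].
Proof.
move=> fD fZ; pose g (x : extension) : U := \sum_i x 0 i *: f (vbase i).
have gL : linear g.
  move=> a x y; rewrite /g scaler_sumr -big_split /=.
  by apply: eq_bigr => i _; rewrite !mxE scalerDl scalerA.
have f0 : f 0 = 0 by apply: (addrI (f 0)); rewrite -fD !addr0.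
have gE v : g (ext v) = f v.
  rewrite {2}[v]vbase_sum (big_morph f fD f0); apply: eq_bigr => i _.
  by rewrite mxE fZ.
exists g; split; [exact: gL|exact: gE|move=> h hL hE x].
have h0 : h 0 = 0.
  have := hL (-1) 0 0; rewrite scaler0 addr0 => ->.
  by rewrite scaleN1r addNr.
have hD : {morph h : y z / y + z}.
  by move=> y z; have := hL 1 y z; rewrite !scale1r.
rewrite [x in LHS]row_sum_delta (big_morph h hD h0); apply: eq_bigr => i _.
have := hL (x 0 i) (delta_mx 0 i) 0; rewrite !addr0 h0 addr0 => ->.
by rewrite -ext_vbase hE.
Qed.

Variable Q : quad_form V.

Definition ext_gram : 'M[K]_(\dim {:V}) :=
  \matrix_(i, j) ratr (polar Q (vbase i) (vbase j) / 2).

Definition ext_quad_fun (x : extension) : K := (x *m ext_gram *m x^T) 0 0.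

Lemma polar_ext x y :
  polar ext_quad_fun x y =
  (x *m ext_gram *m y^T) 0 0 + (y *m ext_gram *m x^T) 0 0.
Proof.
have mxD (A B : 'M[K]_1) : (A + B) 0 0 = A 0 0 + B 0 0 by rewrite mxE.
rewrite /polar /ext_quad_fun linearD /= !mulmxDl !mulmxDr !mxD.
ring.
Qed.

Lemma ext_quadZ a x : ext_quad_fun (a *: x) = a ^+ 2 * ext_quad_fun x.
Proof.
rewrite /ext_quad_fun linearZ /= -!scalemxAl -!scalemxAr scalerA.
by rewrite mxE expr2.
Qed.

Lemma ext_polarP a x y z :
  polar ext_quad_fun (a *: x + y) z =
  a * polar ext_quad_fun x z + polar ext_quad_fun y z.
Proof.
have mxP (c : K) (A B : 'M[K]_1) : (c *: A + B) 0 0 = c * A 0 0 + B 0 0.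
  by rewrite !mxE.
rewrite !polar_ext linearP /= mulmxDr !mulmxDl -!scalemxAl -!scalemxAr !mxP.
ring.
Qed.

Definition ext_quad : quad_form extension := QuadForm ext_quadZ ext_polarP.

Lemma ext_quadE v : [pchar K] =i pred0 -> ext_quad (ext v) = ratr (Q v).
Proof.
move=> charK.
have bE w : polar Q w v = \sum_i coord (vbasis {:V}) i v * polar Q w (vbase i).
  by rewrite {1}[v]vbase_sum polar_sumr; apply: eq_bigr => i _; rewrite polarZr.
have -> : Q v = \sum_i (\sum_j coord (vbasis {:V}) j v *
    (polar Q (vbase j) (vbase i) / 2)) * coord (vbasis {:V}) i v.
  have -> : Q v = polar Q v v / 2.
    by rewrite /polar -mulr2n -scaler_nat quadZ; field.
  rewrite bE mulr_suml; apply: eq_bigr => i _.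
  rewrite polarC bE !mulr_sumr !mulr_suml; apply: eq_bigr => j _.
  by rewrite polarC; ring.
rewrite (ratr_sum_char0 charK) /= /ext_quad_fun mxE; apply: eq_bigr => i _.
rewrite (ratrM_char0 charK) !mxE; congr (_ * _).
rewrite (ratr_sum_char0 charK); apply: eq_bigr => j _.
by rewrite (ratrM_char0 charK) !mxE.
Qed.

End BaseChange.

Section SpecialCliffordGroup.
Variables (K : fieldType) (W : vectType K) (q : quad_form W).

Local Notation Cl := (clifford q).
Local Notation iota := (clifford_in q).

Definition clifford_even : set Cl :=
  [set a | exists s : seq (K * seq W), all (fun p => ~~ odd (size p.2)) s /\
     a = \sum_(p <- s) p.1 *: \prod_(x <- p.2) iota x].

Definition clifford_even_unit : set Cl :=
  [set a | [/\ clifford_even a, a \is a GRing.unit & clifford_even a^-1]].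

Definition clifford_norm (a : Cl) : Cl := a * clifford_sigma a.

Definition clifford_Ad (a b : Cl) : Cl := a * b * a^-1.

Definition special_clifford_group : set Cl :=
  [set a | clifford_even_unit a /\
     forall v, exists w, clifford_Ad a (iota v) = iota w].

(* [iota] is injective, so for [a] in the special Clifford group this is the
   vector that [clifford_Ad a] sends [v] to. *)
Definition vector_Ad (a : Cl) (v : W) : W :=
  xget 0 [set w | clifford_Ad a (iota v) = iota w].

Definition disc (x y : W) : K := q x * q y - 4^-1 * polar q x y ^+ 2.

Definition wedge_nd : set (exterior W) :=
  [set w | exists x y, w = wedge x y /\ disc x y != 0].

Definition orthogonal_planes (v1 v2 v3 v4 : W) : Prop :=
  forall x y, x \in <<[:: v1; v2]>>%VS -> y \in <<[:: v3; v4]>>%VS ->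
    polar q x y = 0.

Definition calQ : set Cl :=
  [set a | [/\ clifford_even_unit a, clifford_sigma a = - a &
     exists2 c : K, c != 0 & clifford_norm a = c%:A]].

Definition clifford_comm (x y : W) : Cl := iota x * iota y - iota y * iota x.

Definition even_center : set Cl :=
  [set z | clifford_even z /\ forall a, clifford_even a -> z * a = a * z].

Definition even_center_basis (u1 u2 : Cl) : Prop :=
  [/\ even_center u1, even_center u2 &
    forall z, even_center z -> exists! c : K * K, z = c.1 *: u1 + c.2 *: u2].

(* The trace of multiplication by [z] on the center is [t]. *)
Definition even_center_trace (z : Cl) (t : K) : Prop :=
  exists u1 u2, even_center_basis u1 u2 /\
    exists a b c d, [/\ z * u1 = a *: u1 + b *: u2,
      z * u2 = c *: u1 + d *: u2 & t = a + d].

Definition traceless (z : Cl) : Prop := even_center_trace z 0.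

End SpecialCliffordGroup.

Arguments clifford_even {K W} q _.
Arguments clifford_even_unit {K W} q _.
Arguments special_clifford_group {K W} q _.
Arguments wedge_nd {K W} q _.
Arguments calQ {K W} q _.
Arguments even_center {K W} q _.

(* Main.v *)
(* The bivector x /\ y is encoded by the endomorphism contract x y :
   v |-> b(y,v) x - b(x,v) y.  It is determined by the wedge (map the exterior
   algebra to nilpotent matrices) and also by the commutator, because
   [[x,y],v] = 2 contract x y v in the Clifford algebra; conversely, if disc is
   non-zero, it determines the value at (x,y) of every alternating bilinear map.
   Hence kappa is well defined and injective; its values satisfy
   [x,y]^2 = -4 disc(x,y), so they lie in calQ.

   For surjectivity, an even a with sigma(a) = -a is a sum of products of two
   orthogonal basis vectors (here dim V = 4 is used), so T = [a,-] maps V to V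
   and is skew.  As a^2 is a non-zero scalar, a anticommutes with T(V) and T^2 is
   a non-zero scalar there, so T(V) contains an anisotropic u; then au is a
   vector w orthogonal to u and a = wu/Q(u) is a multiple of [w,u].

   For orthogonal planes, z = [v3,v4][v1,v2]^-1 anticommutes with v1, ..., v4,
   hence with V, and z^2 is a non-zero scalar.  So z is central in the even
   algebra, {1, z} is a basis of its center, and z has trace 0. *)

Require Import Defs.
From HB Require Import structures.
From mathcomp Require Import all_boot all_order all_algebra ring.
From mathcomp Require Import boolp classical_sets functions.

Set Implicit Arguments.
Unset Strict Implicit.
Unset Printing Implicit Defensive.

Import GRing.Theory.

Local Open Scope ring_scope.

(* Rewriting with the laws of [+%R] would otherwise unfold [polar]. *)
Local Opaque polar.

Lemma four_neq0 (K : fieldType) : (2 : K) != 0 -> (4 : K) != 0.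
Proof. by move=> two_neq0; rewrite (natrM K 2 2) mulf_neq0. Qed.

(** * Bivectors of a quadratic space *)

Section QuadraticSpace.
Variables (K : fieldType) (W : vectType K) (q : quad_form W).
Implicit Types x y u v w : W.

Local Notation b := (polar q).

Lemma polarNl x y : b (- x) y = - b x y.
Proof. by rewrite -scaleN1r polarZl mulN1r. Qed.

Lemma polarNr x y : b x (- y) = - b x y.
Proof. by rewrite -scaleN1r polarZr mulN1r. Qed.

Lemma polar_diag x : b x x = 2 * q x.
Proof.
apply: (addrI (q x + q x)); rewrite -quadD -mulr2n -scaler_nat quadZ.
by rewrite -mulr2n; ring.
Qed.

Definition polarE :=
  (polarDl, polarDr, polarZl, polarZr, polarNl, polarNr, polar_diag).

Definition contract x y v : W := b y v *: x - b x v *: y.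

Lemma contractP a x y z v :
  contract (a *: x + y) z v = a *: contract x z v + contract y z v.
Proof.
rewrite /contract polarDl polarZl scalerDr (scalerDl z) scalerBr !scalerA.
by rewrite [a * b z v]mulrC opprD addrACA.
Qed.

Lemma contractxx x v : contract x x v = 0.
Proof. exact: subrr. Qed.

Lemma contractC x y v : contract x y v = - contract y x v.
Proof. by rewrite opprB. Qed.

Lemma polar_contract x y v w :
  b (contract x y v) w = b y v * b x w - b x v * b y w.
Proof. by rewrite /contract !polarE. Qed.

Section Alternating.
Variables (U : lmodType K) (F : W -> W -> U).
Hypothesis FP : forall a x y z, F (a *: x + y) z = a *: F x z + F y z.
Hypothesis FC : forall x y, F x y = - F y x.
Hypothesis Fxx : forall x, F x x = 0.

Lemma alternating0 z : F 0 z = 0.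
Proof. by have := FP (-1) 0 0 z; rewrite scaler0 addr0 scaleN1r addNr. Qed.

Lemma alternatingDl x y z : F (x + y) z = F x z + F y z.
Proof. by have := FP 1 x y z; rewrite !scale1r. Qed.

Lemma alternatingZl a x z : F (a *: x) z = a *: F x z.
Proof. by have := FP a x 0 z; rewrite alternating0 !addr0. Qed.

Lemma alternatingDr x y z : F z (x + y) = F z x + F z y.
Proof. by rewrite !(FC z) alternatingDl opprD. Qed.

Lemma alternatingZr a x z : F z (a *: x) = a *: F z x.
Proof. by rewrite !(FC z) alternatingZl scalerN. Qed.

Lemma alternating_det (s t s' t' : K) x y :
  F (s *: x + t *: y) (s' *: x + t' *: y) = (s * t' - t * s') *: F x y.
Proof.
rewrite alternatingDl !alternatingDr !alternatingZl !alternatingZr !Fxx.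
by rewrite (FC y x) !scaler0 add0r addr0 !scalerN !scalerA scalerBl.
Qed.

End Alternating.

Hypothesis two_neq0 : (2 : K) != 0.

Lemma disc_polar x y : 4 * disc q x y = b x x * b y y - b x y ^+ 2.
Proof.
have four_neq0 := four_neq0 two_neq0.
by rewrite /disc !polar_diag; field.
Qed.

(** The vector [v] of the plane is orthogonal to [x], so only the [x] term of [contract] survives;
    its coefficient [b y v] is minus the Gram determinant. *)
Lemma contract_disc x y (v := b x y *: x - b x x *: y) :
  contract x y v = - (4 * disc q x y) *: x.
Proof.
rewrite disc_polar /contract /v !polarE [b y x]polarC.
have -> : b x y * (2 * q x) - 2 * q x * b x y = 0 by ring.
by rewrite scale0r subr0; congr (_ *: _); ring.
Qed.

(* [contract x y] is the skew endomorphism attached to the bivector [x /\ y];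
   its values on the plane [<x, y>] already span that plane when [disc != 0]. *)
Lemma alternating_contract (U : lmodType K) (F : W -> W -> U) x y x' y' :
  (forall a x y z, F (a *: x + y) z = a *: F x z + F y z) ->
  (forall x y, F x y = - F y x) -> (forall x, F x x = 0) ->
  disc q x y != 0 -> (forall v, contract x y v = contract x' y' v) ->
  F x y = F x' y'.
Proof.
move=> FP FC Fxx d0 cE.
have four_neq0 := four_neq0 two_neq0.
have dN0 : - (4 * disc q x y) != 0 by rewrite oppr_eq0 mulf_neq0.
have dC : disc q y x = disc q x y by rewrite /disc mulrC polarC.
have in_plane z v : (- (4 * disc q x y)) *: z = contract x' y' v ->
    exists s t, z = s *: x' + t *: y'.
  move=> /(congr1 (fun w => (- (4 * disc q x y))^-1 *: w)).
  rewrite scalerA mulVf // scale1r => ->.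
  by rewrite /contract scalerBr -scaleNr !scalerA; do 2!eexists.
(* By [contract_disc], non-zero multiples of [x] and [y] are values of [contract x y], which is
   [contract x' y'] and has its values in the span of [x'] and [y']. *)
have [s [t xE]] : exists s t, x = s *: x' + t *: y'.
  by apply: in_plane; rewrite -cE -contract_disc.
have [s' [t' yE]] : exists s t, y = s *: x' + t *: y'.
  apply: in_plane (- (b y x *: y - b y y *: x)) _.
  rewrite -dC -contract_disc -cE contractC /contract !polarNr !scaleNr.
  by rewrite !opprB opprK addrC.
(* Passing from [x', y'] to [x, y] multiplies the bivector by the determinant of the coordinates. As
   [contract] is unchanged and has a non-zero value, this determinant is 1. *)
have det1 : s * t' - t * s' = 1.
  have gE z : contract x y z = (s * t' - t * s') *: contract x y z.
    rewrite {1}xE {1}yE cE.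
    apply: (alternating_det (F := fun x y => contract x y z)) => *.
    - exact: contractP.
    - exact: contractC.
    - exact: contractxx.
  have x0 : x != 0.
    apply: contra_neq d0 => ->.
    by rewrite /disc quad0 polar0l mul0r expr0n mulr0 subr0.
  have := gE (b x y *: x - b x x *: y); rewrite contract_disc scalerA.
  move/(congr1 (fun w => w - - (4 * disc q x y) *: x))/eqP.
  rewrite subrr -scalerBl eq_sym scaler_eq0 (negPf x0) orbF.
  rewrite -{2}[- (4 * disc q x y)]mul1r -mulrBl.
  by rewrite mulf_eq0 (negPf dN0) orbF subr_eq0 => /eqP.
by rewrite xE yE (alternating_det FP FC Fxx) det1 scale1r.
Qed.
End QuadraticSpace.

Lemma span_closed (K : fieldType) (W : vectType K) (P : W -> Prop) (s : seq W) v :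
  P 0 -> (forall k x y, P x -> P y -> P (k *: x + y)) ->
  (forall x, x \in s -> P x) -> v \in <<s>>%VS -> P v.
Proof.
move=> P0 Plin Ps /(@coord_span _ _ _ (in_tuple s)) ->.
elim/big_ind: _ => // [x y Px Py|i _].
  by rewrite -[x]scale1r; apply: Plin.
by rewrite -[_ *: _]addr0; apply: Plin => //; apply/Ps/mem_nth.
Qed.

(** * Orthogonal bases *)

Section OrthogonalBasis.
Variables (K : fieldType) (W : vectType K) (q : quad_form W).
Hypothesis two_neq0 : (2 : K) != 0.
Implicit Types (x y u v w : W) (s : seq W).

Local Notation b := (polar q).

Definition orthogonal_seq s : bool :=
  all (fun x => q x != 0) s && pairwise (fun x y => b x y == 0) s.

Lemma orthogonal_seq_cons x s : orthogonal_seq (x :: s) =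
  [&& q x != 0, all (fun y => b x y == 0) s & orthogonal_seq s].
Proof. by rewrite /orthogonal_seq pairwise_cons /= andbACA -andbA. Qed.

Lemma polar_span0 u s v : all (fun y => b u y == 0) s -> v \in <<s>>%VS ->
  b u v = 0.
Proof.
move=> /allP us; apply: (span_closed (P := fun v => b u v = 0))
  => [|k x y ux uy|x /us/eqP//].
  exact: polar0r.
by rewrite polarDr polarZr ux uy mulr0 addr0.
Qed.

Lemma orthogonal_seq_free s : orthogonal_seq s -> free s.
Proof.
elim: s => [|x s IH]; first by rewrite nil_free.
rewrite orthogonal_seq_cons free_cons => /and3P[qx xs /IH ->]; rewrite andbT.
apply: contra qx => /(polar_span0 xs)/eqP.
by rewrite polar_diag mulf_eq0 (negPf two_neq0).
Qed.

(** Gram-Schmidt: [w] is the projection of [v] to the span, which exists because all vectors of [s]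
    are anisotropic. *)
Lemma orthogonal_complement s v : orthogonal_seq s ->
  exists2 w, w \in <<s>>%VS & all (fun x => b (v - w) x == 0) s.
Proof.
elim: s => [_|x s IH]; first by exists 0; rewrite ?mem0v.
rewrite orthogonal_seq_cons => /and3P[qx xs /[dup] orth_s /IH[w ws wP]].
exists (w + (b v x / b x x) *: x).
  rewrite span_cons addrC memv_add //; first by rewrite memvZ ?memv_line.
have dx : b x x != 0 by rewrite polar_diag mulf_neq0.
rewrite /= opprD addrA polarDl polarNl polarZl divfK // polarDl polarNl.
rewrite [b w x]polarC (polar_span0 xs ws) subr0 subrr eqxx.
apply/allP => y ys; rewrite polarDl polarNl polarZl.
by rewrite (eqP (allP xs _ ys)) (eqP (allP wP _ ys)) mulr0 subrr.
Qed.

Lemma orthogonal_seq_exists (nd : quad_nondegenerate q) k :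
  (k <= \dim {:W})%N -> exists2 s, orthogonal_seq s & size s = k.
Proof.
elim: k => [_|k IH lt_k]; first by exists [::].
have [s orth_s size_s] := IH (ltnW lt_k).
suff [u qu us] : exists2 u, q u != 0 & all (fun x => b u x == 0) s.
  by exists (u :: s); rewrite /= ?size_s // orthogonal_seq_cons qu us.
have [v vs] : exists v, v \notin <<s>>%VS.
  apply/not_existsP => sP; have : (\dim {:W} <= \dim <<s>>)%N.
    by apply/dimvS/subvP => v _; have /negP := sP v; rewrite negbK.
  by apply/negP; rewrite -ltnNge (leq_ltn_trans (dim_span _)) ?size_s.
have [w ws] := orthogonal_complement v orth_s; set u := v - w => us.
have [qu|qu] := eqVneq (q u) 0; last by exists u.
(* If [u] is isotropic, non-degeneracy gives a [y] pairing with it, still after projection away from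
   [s]. If [y'] is isotropic too, then [q (u + y') = b u y'] is non-zero. *)
have [y uy] : exists y, b u y != 0.
  apply/not_existsP => uP; have u0 : u = 0.
    by apply: nd => y; apply/eqP; have /negP := uP y; rewrite negbK.
  by rewrite -[v](subrK w) -/u u0 add0r ws in vs.
have [z zs] := orthogonal_complement y orth_s; set y' := y - z => y's.
have uy' : b u y' = b u y by rewrite polarDr polarNr (polar_span0 us zs) subr0.
have [qy'|qy'] := eqVneq (q y') 0; last by exists y'.
exists (u + y'); first by rewrite quadD qu qy' !add0r uy'.
apply/allP => x xs; rewrite polarDl (eqP (allP us _ xs)) add0r.
exact: (allP y's).
Qed.

Lemma orthogonal_seq_span s v : orthogonal_seq s -> size s = \dim {:W} ->
  v \in <<s>>%VS.
Proof.
move=> /orthogonal_seq_free fs size_s.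
suff /span_basis -> : basis_of {:W} s by rewrite memvf.
by rewrite basisEfree fs subvf size_s leqnn.
Qed.

End OrthogonalBasis.

(** * Algebras generated by a quadratic space *)

(* Everything is proved for an arbitrary algebra [A] with a linear map [e]
   satisfying [e x ^ 2 = q x]: on the quotient type [clifford q] itself,
   unification unfolds the ring operations and diverges. *)
Section CliffordAlgebra.
Variables (K : fieldType) (W : vectType K) (q : quad_form W).
Variables (A : algType K) (e : {linear W -> A}).
Hypothesis e_sqr : forall x, e x * e x = (q x)%:A.
Hypothesis two_neq0 : (2 : K) != 0.
Implicit Types (x y u v w : W) (a c : A).

Local Notation b := (polar q).

Lemma scalar_inj : injective (fun k : K => k%:A : A).
Proof.
move=> k l /eqP; rewrite -subr_eq0 -scalerBl scaler_eq0 oner_eq0 orbF subr_eq0.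
by move/eqP.
Qed.

Lemma in_polar x y : e x * e y + e y * e x = (b x y)%:A.
Proof.
have := e_sqr (x + y); rewrite linearD mulrDl !mulrDr !e_sqr quadD !scalerDl.
by rewrite addrA -[_ + _ + e y * e x]addrA addrAC => /addrI.
Qed.

Lemma in_swap x y : e x * e y = (b x y)%:A - e y * e x.
Proof. by rewrite -in_polar addrK. Qed.

Lemma in_inj : quad_nondegenerate q -> injective e.
Proof.
move=> nd x y /eqP; rewrite -subr_eq0 -linearB => /eqP e0.
apply/eqP; rewrite -subr_eq0; apply/eqP/nd => v; apply: scalar_inj.
by rewrite -in_polar e0 mul0r mulr0 addr0 scale0r.
Qed.

Definition commutator x y : A := e x * e y - e y * e x.

Lemma commutatorP k x y z :
  commutator (k *: x + y) z = k *: commutator x z + commutator y z.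
Proof.
rewrite /commutator linearP mulrDl mulrDr -scalerAl -scalerAr scalerBr.
by rewrite opprD addrACA.
Qed.

Lemma commutatorC x y : commutator x y = - commutator y x.
Proof. by rewrite /commutator opprB. Qed.

Lemma commutatorxx x : commutator x x = 0.
Proof. exact: subrr. Qed.

Lemma in_mul_contract x y v :
  e x * e y * e v - e v * (e x * e y) = e (contract q x y v).
Proof.
rewrite -mulrA [e y * e v]in_swap mulrBr mulr_algr !mulrA.
rewrite [e x * e v]in_swap mulrBl mulr_algl opprB addrA addrAC addrK.
by rewrite /contract linearB !linearZ.
Qed.

Lemma commutator_contract x y v :
  commutator x y * e v - e v * commutator x y = e (2 *: contract q x y v).
Proof.
rewrite /commutator mulrBl mulrBr opprD addrACA -opprD !in_mul_contract.
by rewrite [contract q y x v]contractC linearN opprK -linearD scaler_nat mulr2n.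
Qed.

Lemma commutatorEl x y : commutator x y = 2 *: (e x * e y) - (b x y)%:A.
Proof. by rewrite -in_polar scaler_nat mulr2n opprD addrACA subrr add0r. Qed.

Lemma commutatorEr x y : commutator x y = (b x y)%:A - 2 *: (e y * e x).
Proof. by rewrite commutatorC commutatorEl opprB polarC. Qed.

(** With one factor written as 2xy - b(x,y) and the other as b(x,y) - 2yx, the quartic term contains
    the scalar xyyx, and the cross terms combine through xy + yx = b(x,y). *)
Lemma commutator_sqr x y :
  commutator x y * commutator x y = (- (4 * disc q x y))%:A.
Proof.
rewrite (disc_polar _ two_neq0) !polar_diag {1}commutatorEl commutatorEr.
rewrite mulrBl !mulrBr !mulr_algl !mulr_algr.
rewrite -!scalerAl -!scalerAr.
have -> : e x * e y * (e y * e x) = (q x * q y)%:A.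
  by rewrite mulrA -[e x * e y * _]mulrA e_sqr mulr_algr -scalerAl e_sqr
    scalerA mulrC.
rewrite opprB addrACA -!scalerDr in_polar !scalerA -!scaleNr -!scalerDl.
by congr (_ *: _); ring.
Qed.

Lemma commutator_anti x y : e x * commutator x y = - (commutator x y * e x).
Proof.
rewrite /commutator mulrBl mulrBr opprB [e x * (e x * e y)]mulrA e_sqr.
by rewrite -[e y * e x * e x]mulrA e_sqr mulr_algl mulr_algr mulrA.
Qed.

Lemma commutator_antir x y : e y * commutator x y = - (commutator x y * e y).
Proof. by rewrite commutatorC mulrN mulNr commutator_anti. Qed.

(** When [e] is the inclusion into [clifford q], this is convertible to [clifford_even q], so the
    results below apply there directly. *)
Definition even_span : set A :=
  [set a | exists s : seq (K * seq W), all (fun p => ~~ odd (size p.2)) s /\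
     a = \sum_(p <- s) p.1 *: \prod_(x <- p.2) e x].

Lemma even_span_lin k a c :
  even_span a -> even_span c -> even_span (k *: a + c).
Proof.
move=> [s [s_even ->]] [t [t_even ->]].
exists ([seq (k * p.1, p.2) | p <- s] ++ t); split.
  by rewrite all_cat all_map t_even andbT.
rewrite big_cat big_map scaler_sumr /=; congr (_ + _).
by apply: eq_bigr => p _; rewrite scalerA.
Qed.

Lemma even_span0 : even_span 0.
Proof. by exists [::]; rewrite big_nil. Qed.

Lemma even_spanZ k a : even_span a -> even_span (k *: a).
Proof. by move=> ha; rewrite -[k *: a]addr0; apply: even_span_lin even_span0. Qed.

Lemma even_spanD a c : even_span a -> even_span c -> even_span (a + c).
Proof. by rewrite -{2}[a]scale1r; apply: even_span_lin. Qed.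

Lemma even_span_prod (s : seq W) :
  ~~ odd (size s) -> even_span (\prod_(x <- s) e x).
Proof. by move=> s_even; exists [:: (1, s)]; rewrite /= s_even big_seq1 scale1r. Qed.

Lemma even_span1 : even_span 1.
Proof. by have := @even_span_prod [::] isT; rewrite big_nil. Qed.

Lemma even_spanM a c : even_span a -> even_span c -> even_span (a * c).
Proof.
move=> [s [s_even ->]] [t [t_even ->]]; rewrite mulr_suml big_seq.
elim/big_ind: _ => [||p ps]; [exact: even_span0|exact: even_spanD|].
rewrite mulr_sumr big_seq.
elim/big_ind: _ => [||r rt]; [exact: even_span0|exact: even_spanD|].
rewrite -scalerAl -scalerAr -big_cat; do 2!apply: even_spanZ.
apply: even_span_prod; rewrite size_cat oddD.
by rewrite (negPf (allP s_even _ ps)) (negPf (allP t_even _ rt)).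
Qed.

Lemma even_span_in2 u v : even_span (e u * e v).
Proof.
by have := @even_span_prod [:: u; v] isT; rewrite big_cons big_seq1.
Qed.

Lemma even_span_commutator x y : even_span (commutator x y).
Proof.
rewrite /commutator addrC -scaleN1r.
by apply: even_span_lin; apply: even_span_in2.
Qed.

(** * Monomials in an orthogonal basis *)

Section Monomials.
Variable s : seq W.
Hypothesis orth_s : orthogonal_seq q s.

Local Notation mono t := (\prod_(x <- t) e x).

Lemma in_anti x y : b x y = 0 -> e x * e y = - (e y * e x).
Proof. by move=> xy0; rewrite in_swap xy0 scale0r sub0r. Qed.

(** Move [x] to its place in the order of [s], anticommuting with the vectors before it. There it is
    inserted, or cancels against its own copy to the scalar [q x]; either way the parity of the
    length flips. *)
Lemma mul_in_mono x t : x \in s -> subseq t s ->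
  exists k t', [/\ subseq t' s, odd (size t') = ~~ odd (size t) &
    e x * mono t = k *: mono t'].
Proof.
elim: s orth_s t => [//|y r IH] + t; rewrite orthogonal_seq_cons.
move=> /and3P[qy /allP yr orth_r]; rewrite inE; case: t => [|z t].
  move=> xyr _; exists 1, [:: x]; rewrite sub1seq inE xyr.
  by rewrite big_seq1 big_nil mulr1 scale1r.
case/predU1P => [->|xr] /=; case: eqP => [->|_] tr.
- exists (q y), t; rewrite negbK big_cons mulrA e_sqr mulr_algl.
  by split=> //; apply: subseq_trans tr (subseq_cons r y).
- exists 1, (y :: z :: t); rewrite /= eqxx scale1r.
  by rewrite [\prod_(i <- y :: _) _]big_cons.
- have [k [t' [t'r odd_t' xtE]]] := IH orth_r t xr tr.
  have xy0 : b x y = 0 by rewrite polarC; apply/eqP/yr.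
  exists (- k), (y :: t'); rewrite /= eqxx odd_t' !big_cons mulrA.
  by rewrite (in_anti xy0) mulNr -mulrA xtE -scalerAr scaleNr.
have [k [t' [t'r odd_t' xtE]]] := IH orth_r (z :: t) xr tr.
by exists k, t'; split=> //; apply: subseq_trans t'r (subseq_cons r y).
Qed.

Hypothesis size_s : size s = \dim {:W}.

Lemma even_span_ind (P : A -> Prop) :
  P 0 -> (forall k a c, P a -> P c -> P (k *: a + c)) ->
  (forall t, subseq t s -> ~~ odd (size t) -> P (mono t)) ->
  forall a, even_span a -> P a.
Proof.
move=> P0 Plin Pmono a [r [r_even ->]]; rewrite big_seq.
elim/big_ind: _ => // [c d Pc Pd|p pr]; first by rewrite -[c]scale1r; apply: Plin.
rewrite -[_ *: _]addr0; apply: (Plin) => //; move: (allP r_even _ pr) => {pr}.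
(* The property varies in this induction: to multiply by [x] on the left, the hypothesis for the
   tail is applied to [fun a => P' (e x * a)]. *)
have span_mono t (P' : A -> Prop) : P' 0 ->
    (forall k a c, P' a -> P' c -> P' (k *: a + c)) ->
    (forall t', subseq t' s -> odd (size t') = odd (size t) -> P' (mono t')) ->
    P' (mono t).
  elim: t P' => [|x t IH] P' P'0 P'lin P'mono.
    by apply: P'mono => //; rewrite sub0seq.
  rewrite big_cons.
  apply: (IH (fun a => P' (e x * a))) => [|k c d Pc Pd|t' t's odd_t'].
  - by rewrite mulr0.
  - by rewrite mulrDr -scalerAr; apply: P'lin.
  have := orthogonal_seq_span two_neq0 x orth_s size_s.
  apply: (span_closed (P := fun x => P' (e x * mono t'))) => [|k y z Py Pz|y ys].
  - by rewrite linear0 mul0r.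
  - by rewrite linearP mulrDl -scalerAl; apply: P'lin.
  have [k [t2 [t2s odd_t2 ->]]] := mul_in_mono ys t's.
  rewrite -[_ *: _]addr0; apply: P'lin => //; apply: P'mono => //.
  by rewrite odd_t2 odd_t'.
move=> p_even; apply: span_mono => // t ts.
by rewrite (negPf p_even) => /negbT/(Pmono _ ts).
Qed.

Lemma in_mono_sign x t : x \notin t -> {in t, forall y, b x y = 0} ->
  e x * mono t = (-1) ^+ size t *: (mono t * e x).
Proof.
elim: t => [|y t IH]; first by rewrite !big_nil mulr1 mul1r scale1r.
rewrite inE negb_or => /andP[_ xt] xt0; rewrite !big_cons mulrA.
rewrite (in_anti (xt0 y (mem_head y t))) mulNr.
rewrite -[e y * e x * _]mulrA IH // => [|z zt].
  by rewrite exprS mulN1r scaleNr -scalerAr mulrA.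
by rewrite xt0 // inE zt orbT.
Qed.

(** Each [x] contributes the operator sending a to a + x a x^-1, where x^-1 = x/q(x). It doubles
    what commutes with [x] and kills what anticommutes with it. *)
Local Notation conj_sum := (foldr (fun x a => a + (q x)^-1 *: (e x * a * e x))).

Lemma conj_sum_lin t k a c :
  conj_sum (k *: a + c) t = k *: conj_sum a t + conj_sum c t.
Proof.
elim: t => //= x t ->; rewrite mulrDr mulrDl -scalerAr -scalerAl.
by rewrite !scalerDr !scalerA mulrC addrACA.
Qed.

Lemma conj_sum_comm t a : {subset t <= s} ->
  (forall x, e x * a = a * e x) -> conj_sum a t = 2 ^+ size t *: a.
Proof.
move=> + aC; elim: t => [_|x t IH ts] /=; first by rewrite scale1r.
have qx : q x != 0 by case/andP: orth_s => /allP + _; apply; rewrite ts ?mem_head.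
rewrite IH => [|y yt]; last by rewrite ts // inE yt orbT.
rewrite -scalerAr -scalerAl aC -mulrA e_sqr mulr_algr !scalerA mulrAC mulVf //.
by rewrite mul1r exprS -scalerDl mulrDl mul1r.
Qed.

(** If [x] is not in [t], it anticommutes past an even number of vectors. If it is, it commutes with
    its own copy, which leaves an odd number of signs. *)
Lemma in_even_mono x t : x \in s -> subseq t s -> ~~ odd (size t) ->
  e x * mono t = (-1) ^+ (x \in t) *: (mono t * e x).
Proof.
move=> xs ts even_t; have orth_neq y z : y \in s -> z \in s -> y != z -> b y z = 0.
  have [_ /pairwiseP orth] := andP orth_s.
  move=> /(nthP 0)[i lt_i <-] /(nthP 0)[j lt_j <-].
  have [ij|ji|->] := ltngtP i j; last by rewrite eqxx.
  - by move=> _; apply/eqP/orth.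
  - by move=> _; rewrite polarC; apply/eqP/orth.
have uniq_s : uniq s.
  apply: free_uniq (orthogonal_seq_free two_neq0 orth_s).
have t_sub := mem_subseq ts.
have sign_mono r : x \notin r -> {subset r <= s} ->
    e x * mono r = (-1) ^+ size r *: (mono r * e x).
  move=> xr r_sub; apply: in_mono_sign => // y yr.
  by apply: orth_neq => //; [apply: r_sub | apply: contraNneq xr => ->].
have [xt|xt] := boolP (x \in t); last first.
  by rewrite sign_mono // -signr_odd (negPf even_t).
have uniq_t := subseq_uniq ts uniq_s.
case/splitPr: xt even_t t_sub uniq_t => t1 t2 even_t t_sub.
rewrite cat_uniq /= negb_or => /and3P[_ /andP[xt1 _] /andP[xt2 _]].
rewrite big_cat big_cons /= mulrA sign_mono //; last first.
  by move=> y yt; rewrite t_sub // mem_cat yt.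
rewrite -scalerAl -!mulrA.
have -> : e x * mono t2 = (-1) ^+ size t2 *: (mono t2 * e x).
  by rewrite sign_mono // => y yt; rewrite t_sub // mem_cat inE yt !orbT.
rewrite -!scalerAr !scalerA -exprD; congr (_ *: _).
rewrite -[LHS]signr_odd oddD; move: even_t; rewrite size_cat /= addnS /= oddD negbK.
by move=> ->.
Qed.

Lemma conj_sum_mono t r : subseq t s -> ~~ odd (size t) -> {subset r <= s} ->
  exists2 k, conj_sum (mono t) r = k *: mono t & has (mem t) r -> k = 0.
Proof.
move=> ts even_t; elim: r => [_|x r IH xr] /=.
  by exists 1; rewrite ?scale1r.
have [y yr|k -> k0] := IH; first by rewrite xr // inE yr orbT.
have xs : x \in s by rewrite xr ?mem_head.
have qx : q x != 0 by case/andP: orth_s => /allP + _; apply.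
exists (k + (-1) ^+ (x \in t) * k).
  rewrite -scalerAr -scalerAl in_even_mono // -scalerAl -mulrA e_sqr mulr_algr.
  by rewrite !scalerA -scalerDl; congr (_ *: _); field.
case: (x \in t) => /= [_|/k0->]; first by rewrite mulN1r subrr.
by rewrite mulr0 addr0.
Qed.

(** Over the whole basis, [conj_sum] multiplies [a] by a power of 2. It also kills every non-empty
    even monomial, since that anticommutes with its own vectors, so only the scalar term remains. *)
Lemma even_central_scalar a :
  even_span a -> (forall x, e x * a = a * e x) -> exists k : K, a = k%:A.
Proof.
move=> a_even aC; have two_exp_neq0 n : (2 : K) ^+ n != 0 by rewrite expf_neq0.
suff [k aE] : exists k : K, conj_sum a s = k%:A.
  exists ((2 ^+ size s)^-1 * k); rewrite -scalerA -aE conj_sum_comm // scalerA.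
  by rewrite mulVf ?scale1r.
move: a_even.
apply: (even_span_ind (P := fun a => exists k : K, conj_sum a s = k%:A)).
- exists 0; rewrite conj_sum_comm // => [|x]; first by rewrite scaler0 scale0r.
  by rewrite mulr0 mul0r.
- move=> k c d [kc cE] [kd dE]; exists (k * kc + kd).
  by rewrite conj_sum_lin cE dE scalerDl scalerA.
move=> t ts even_t; have [k -> k0] := conj_sum_mono ts even_t (fun x xs => xs).
case: t ts even_t k0 => [|x t] ts even_t k0; first by exists k; rewrite big_nil.
exists 0; rewrite k0 ?scale0r //; apply/hasP; exists x; rewrite ?inE ?eqxx //.
by rewrite (mem_subseq ts) ?mem_head.
Qed.

End Monomials.

(** * Skew even elements are commutators *)

Section Surjectivity.
Hypothesis nd : quad_nondegenerate q.
Hypothesis dimW : \dim {:W} = 4%N.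
Variable sigma : {linear A -> A}.
Hypothesis sigma1 : sigma 1 = 1.
Hypothesis sigmaM : forall a c, sigma (a * c) = sigma c * sigma a.
Hypothesis sigma_in : forall x, sigma (e x) = - e x.

Lemma sigma_commutator x y : sigma (commutator x y) = - commutator x y.
Proof.
by rewrite /commutator linearB /= !sigmaM !sigma_in !mulrNN opprB.
Qed.

Lemma norm_commutator x y :
  commutator x y * sigma (commutator x y) = (4 * disc q x y)%:A.
Proof. by rewrite sigma_commutator mulrN commutator_sqr scaleNr opprK. Qed.

(** The induction runs over the skew part [a - sigma a], which is linear in [a] and equals 2a here.
    For monomials of length 0 and 4 it vanishes; for length 2 it is a commutator. *)
Lemma skew_even_bracket a : even_span a -> sigma a = - a ->
  forall v, exists w, a * e v - e v * a = e w.
Proof.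
have [s orth_s size_s] := orthogonal_seq_exists two_neq0 nd (leqnn _).
move=> a_even sigma_a v; pose skew c := c - sigma c.
suff [w wE] : exists w, skew a * e v - e v * skew a = e w.
  exists (2^-1 *: w); rewrite linearZ /= -wE /skew sigma_a opprK -mulr2n -scaler_nat.
  by rewrite -scalerAl -scalerAr -scalerBr scalerA mulVf // scale1r.
move: a_even.
apply: (even_span_ind orth_s size_s
  (P := fun a => exists w, skew a * e v - e v * skew a = e w)).
- by exists 0; rewrite /skew [sigma 0]linear0 subrr mul0r mulr0 subrr linear0.
- move=> k c d [w wE] [w' w'E]; exists (k *: w + w').
  rewrite linearP -wE -w'E /skew linearP opprD addrACA -scalerBr.
  by rewrite mulrDl mulrDr -scalerAl -scalerAr scalerBr opprD addrACA.
move=> t ts even_t; have := size_subseq ts; rewrite size_s dimW.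
have [_ orth] := andP orth_s.
have := subseq_pairwise ts orth.
case: t ts even_t => [|x [|y [|z [|u [|//]]]]] //= ts _.
- by exists 0; rewrite /skew big_nil sigma1 subrr mul0r mulr0 subrr linear0.
- rewrite !big_cons big_nil mulr1 /skew sigmaM !sigma_in mulrNN.
  by exists (2 *: contract q x y v); apply: commutator_contract.
rewrite !andbT => /and3P[/and3P[/eqP xy /eqP xz /eqP xu]].
move=> /andP[/eqP yz /eqP yu] /eqP zu _.
exists 0; rewrite !big_cons big_nil mulr1 /skew !sigmaM !sigma_in.
rewrite !mulrN !mulNr !opprK.
(* Reversing four pairwise orthogonal vectors takes six transpositions, so the sign is +1. *)
have -> : e u * e z * e y * e x = e x * (e y * (e z * e u)).
  rewrite (in_anti zu) !mulrN [e y * _]mulrA (in_anti yu) mulNr mulrN opprK.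
  rewrite -[e u * e y * _]mulrA [e x * _]mulrA (in_anti xu) mulNr.
  rewrite -[e u * e x * _]mulrA.
  rewrite (in_anti yz) !mulrN opprK [e x * _]mulrA (in_anti xz) mulNr.
  rewrite -[e z * e x * _]mulrA.
  by rewrite (in_anti xy) !mulrN opprK !mulrA.
by rewrite subrr mul0r mulr0 subrr linear0.
Qed.

(** The bracket with [a] is a derivation and kills the scalar vw + wv = b(v,w). *)
Lemma bracket_skew a (T : W -> W) :
  (forall v, a * e v - e v * a = e (T v)) ->
  forall v w, b (T v) w = - b v (T w).
Proof.
move=> TE v w; apply: scalar_inj; rewrite scaleNr -!in_polar -!TE.
have leibniz c d : (a * c - c * a) * d + c * (a * d - d * a) =
    a * (c * d) - c * d * a.
  by rewrite mulrBl mulrBr !mulrA addrA subrK.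
apply/eqP; rewrite -addr_eq0 addrACA leibniz [e w * _ + _]addrC leibniz.
by rewrite addrACA -mulrDr -opprD -mulrDl in_polar mulr_algl mulr_algr subrr.
Qed.

Lemma skew_even_commutator a l : even_span a -> sigma a = - a ->
  l != 0 -> a * sigma a = l%:A -> exists x y, a = commutator x y.
Proof.
move=> a_even sigma_a l0; rewrite sigma_a mulrN => a_norm.
have [k k0 a_sqr] : exists2 k : K, k != 0 & a * a = k%:A.
  by exists (- l); rewrite ?oppr_eq0 // scaleNr -a_norm opprK.
have /choice[T TE] := skew_even_bracket a_even sigma_a.
have T_skew := bracket_skew TE.
have anti v : a * e (T v) = - (e (T v) * a).
  apply/eqP; rewrite -addr_eq0 -TE mulrBl mulrBr !mulrA a_sqr addrA subrK.
  by rewrite -mulrA a_sqr mulr_algl mulr_algr subrr.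
have TTE v : e (T (T v)) = 2 *: (a * e (T v)).
  by rewrite -TE -[X in _ - X]opprK -anti opprK scaler_nat mulr2n.
have T2E v : T (T (T v)) = (4 * k) *: T v.
  apply: (in_inj nd); rewrite TTE TTE -scalerAr mulrA a_sqr mulr_algl !scalerA.
  by rewrite linearZ -natrM.
have k40 : 4 * k != 0 by rewrite (natrM K 2 2) !mulf_neq0.
(* If the image of [T] were totally isotropic, polarization and skewness would make 4k b(Tv,w) =
   -b(TTv,Tw) vanish, so [T] would be 0. Then [a] would be a scalar, and zero by [sigma a = - a],
   against [a * a] being non-zero. *)
have [u qTu] : exists u, q (T u) != 0.
  apply/not_existsP => qT0.
  have {}qT0 u : q (T u) = 0 by apply/eqP; have /negP := qT0 u; rewrite negbK.
  have TD v w : T v + T w = T (v + w).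
    apply: (in_inj nd); rewrite linearD -!TE linearD mulrDl mulrDr.
    by rewrite opprD addrACA.
  have T0 v : T v = 0.
    apply: nd => w; apply: (mulfI k40).
    rewrite -polarZl -T2E T_skew mulr0; have := quadD q (T (T v)) (T w).
    by rewrite TD !qT0 !add0r => <-; rewrite oppr0.
  have [s orth_s size_s] := orthogonal_seq_exists two_neq0 nd (leqnn _).
  have [m aE] : exists m, a = m%:A.
    apply: (even_central_scalar orth_s size_s a_even) => x.
    by apply/esym/eqP; rewrite -subr_eq0 TE T0 linear0.
  have m0 : m = 0.
    move: sigma_a; rewrite aE linearZ /= sigma1 -scaleNr => /scalar_inj/eqP.
    by rewrite -addr_eq0 -mulr2n -mulr_natl mulf_eq0 (negPf two_neq0) => /eqP.
  move: a_sqr; rewrite aE m0 scale0r mul0r => /eqP.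
  by rewrite eq_sym scaler_eq0 oner_eq0 (negPf k0).
set U := e (T u); have U_sqr : U * U = (q (T u))%:A by apply: e_sqr.
(* The constant 4 absorbs one factor 2 from [TTE] and one from the commutator, whose two terms agree
   since [a] anticommutes with [U]. *)
pose w := (4 * q (T u))^-1 *: T (T u); exists w, (T u).
have four_neq0 := four_neq0 two_neq0.
have wE : e w = (2 * q (T u))^-1 *: (a * U).
  by rewrite linearZ /= TTE scalerA; congr (_ *: _); field; rewrite qTu two_neq0.
rewrite /commutator -/U wE -scalerAr -scalerAl -scalerBr mulrA.
rewrite -[U * a]opprK -anti mulNr opprK -mulr2n -scaler_nat -mulrA U_sqr mulr_algr.
by rewrite !scalerA -[LHS]scale1r; congr (_ *: _); field; rewrite qTu two_neq0.
Qed.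

End Surjectivity.

(** * The center of the even algebra *)

Section Center.
Hypothesis nd : quad_nondegenerate q.

Definition even_centralizer : set A :=
  [set z | even_span z /\ forall a, even_span a -> z * a = a * z].

Lemma even_span_sandwich u v a : even_span a -> even_span (e u * a * e v).
Proof.
move=> [r [r_even ->]]; rewrite mulr_sumr mulr_suml big_seq.
elim/big_ind: _ => [||p pr]; [exact: even_span0|exact: even_spanD|].
rewrite -scalerAr -scalerAl; apply: even_spanZ.
have := @even_span_prod (u :: rcons p.2 v).
rewrite big_cons big_rcons /= mulrA; apply.
by rewrite size_rcons /= negbK (allP r_even).
Qed.

Lemma anti_in_even_central z a : (forall v, e v * z = - (z * e v)) ->
  even_span a -> z * a = a * z.
Proof.
move=> zN [r [r_even ->]]; rewrite mulr_sumr mulr_suml; apply: eq_big_seq => p pr.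
rewrite -scalerAr -scalerAl; congr (_ *: _).
have -> : \prod_(x <- p.2) e x * z =
    (-1) ^+ size p.2 *: (z * \prod_(x <- p.2) e x).
  elim: p.2 => [|x t IH]; first by rewrite !big_nil mulr1 mul1r scale1r.
  rewrite !big_cons -mulrA IH -scalerAr [e x * (z * _)]mulrA zN mulNr scalerN -mulrA.
  by rewrite exprS mulN1r scaleNr.
by rewrite -signr_odd (negPf (allP r_even _ pr)) scale1r.
Qed.

(** With [u] anisotropic and c' = u c u^-1, centrality of [c] gives vc = c'v and cv = vc' for every
    vector v. Hence c + c' and (c - c')z commute with all vectors and are scalars, which determines
    [c]. *)
Lemma even_centralizer_basis z k c :
  even_span z -> (forall v, e v * z = - (z * e v)) -> z * z = k%:A -> k != 0 ->
  (0 < \dim {:W})%N -> even_centralizer c ->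
  exists! p : K * K, c = p.1 *: 1 + p.2 *: z.
Proof.
move=> z_even zN z_sqr k0 dimW [c_even cC].
have [s orth_s size_s] := orthogonal_seq_exists two_neq0 nd (leqnn _).
have [u qu] : exists u, q u != 0.
  case: (s) (orth_s) (size_s) dimW => [_ <- //|u r + _ _].
  by rewrite orthogonal_seq_cons => /and3P[]; exists u.
pose c' := (q u)^-1 *: (e u * c * e u).
have uK a : (q u)^-1 *: (a * e u * e u) = a.
  by rewrite -mulrA e_sqr mulr_algr scalerA mulVf // scale1r.
have uKl a : (q u)^-1 *: (e u * (e u * a)) = a.
  by rewrite mulrA e_sqr mulr_algl scalerA mulVf // scale1r.
have vc v : e v * c = c' * e v.
  rewrite -[LHS]uKl [e u * (e v * c)]mulrA -cC; last exact: even_span_in2.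
  by rewrite /c' -scalerAl !mulrA.
have cv v : c * e v = e v * c'.
  rewrite -[LHS]uK -[c * e v * e u]mulrA cC; last exact: even_span_in2.
  by rewrite /c' -scalerAr !mulrA.
have c'_even : even_span c' by apply/even_spanZ/even_span_sandwich.
have [l lE] : exists l : K, c + c' = l%:A.
  apply: (even_central_scalar orth_s size_s); first exact: even_spanD.
  by move=> x; rewrite mulrDr mulrDl vc cv addrC.
have [m mE] : exists m : K, (c - c') * z = m%:A.
  apply: (even_central_scalar orth_s size_s).
    by apply: even_spanM => //; rewrite -scaleN1r addrC; apply: even_span_lin.
  move=> x; rewrite -[RHS]mulrA -[z * e x]opprK -zN mulrN mulrA mulrA -mulNr.
  by rewrite mulrBr [in RHS]mulrBl vc -cv opprB.
have zK a : k^-1 *: (a * z * z) = a.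
  by rewrite -mulrA z_sqr mulr_algr scalerA mulVf // scale1r.
have cE : c = (l / 2) *: 1 + (m / (2 * k)) *: z.
  have -> : c = 2^-1 *: ((c + c') + (c - c')).
    rewrite addrACA subrr addr0 -mulr2n -scaler_nat scalerA mulVf //.
    by rewrite scale1r.
  rewrite lE -[c - c']zK mE mulr_algl scalerDr !scalerA /=.
  by congr (_ *: _ + _ *: _); field; rewrite ?k0 ?two_neq0.
(* The anticommutator with [u] kills the [z] term of a relation and leaves 2ru = 0. *)
have free_1z r t : r *: 1 + t *: z = 0 :> A -> r = 0 /\ t = 0.
  move=> rt0; have : e u * (r *: 1 + t *: z) + (r *: 1 + t *: z) * e u = 0.
    by rewrite rt0 mulr0 mul0r addr0.
  rewrite mulrDr mulrDl -!scalerAr -!scalerAl zN mulr1 mul1r scalerN addrACA.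
  rewrite addNr addr0 -scalerDl => ru0.
  have r0 : r = 0.
    have /eqP := congr1 (fun a => a * e u) ru0.
    rewrite mul0r -scalerAl e_sqr scalerA scaler_eq0 oner_eq0 orbF mulf_eq0.
    by rewrite (negPf qu) orbF -mulr2n -mulr_natl mulf_eq0 (negPf two_neq0) => /eqP.
  split=> //; have /eqP := congr1 (fun a => a * z) rt0.
  rewrite r0 scale0r add0r mul0r -scalerAl z_sqr scalerA scaler_eq0 oner_eq0.
  by rewrite orbF mulf_eq0 (negPf k0) orbF => /eqP.
exists (l / 2, m / (2 * k)); split=> // -[r t] /= cE'.
have [] := free_1z (l / 2 - r) (m / (2 * k) - t).
  by rewrite !scalerBl addrACA -opprD -cE -cE' subrr.
by move=> /subr0_eq -> /subr0_eq ->.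
Qed.

(** The statement is [traceless] unfolded for a general algebra. In the basis 1, z, multiplication
    by [z] has zero diagonal because [z * z] is a scalar. *)
Lemma traceless_basis z k : even_span z -> (forall v, e v * z = - (z * e v)) ->
  z * z = k%:A -> k != 0 -> (0 < \dim {:W})%N ->
  exists c1 c2, [/\ even_centralizer c1, even_centralizer c2 &
    forall c, even_centralizer c ->
      exists! p : K * K, c = p.1 *: c1 + p.2 *: c2] /\
  exists r t r' t', [/\ z * c1 = r *: c1 + t *: c2,
    z * c2 = r' *: c1 + t' *: c2 & 0 = r + t' :> K].
Proof.
move=> z_even zN z_sqr k0 dimW; exists 1, z; split.
  split=> [||c]; first by split=> [|a _]; [exact: even_span1 | rewrite mul1r mulr1].
  - by split=> // a; apply: anti_in_even_central.
  - exact: (even_centralizer_basis z_even zN z_sqr k0 dimW).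
by exists 0, 1, k, 0; rewrite z_sqr mulr1 !scale0r scale1r add0r !addr0.
Qed.

Lemma commutator_comm a x y : a * e x = e x * a -> a * e y = e y * a ->
  a * commutator x y = commutator x y * a.
Proof.
by move=> ax ay; rewrite /commutator mulrBr mulrBl !mulrA ax ay -!mulrA ax ay.
Qed.

(** Cramer's rule: the Gram determinant of [x], [y] is [4 * disc q x y]. *)
Lemma nondegenerate_plane x y r t : disc q x y != 0 ->
  b x (r *: x + t *: y) = 0 -> b y (r *: x + t *: y) = 0 -> r = 0 /\ t = 0.
Proof.
rewrite !polarDr !polarZr => d0 xE yE.
have four_neq0 := four_neq0 two_neq0.
have d40 : 4 * disc q x y != 0 by rewrite mulf_neq0.
split; apply: (mulfI d40); rewrite mulr0 (disc_polar _ two_neq0).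
  rewrite -(mulr0 (b y y)) -xE -[RHS]subr0 -(mulr0 (b x y)) -yE [b y x]polarC.
  by ring.
rewrite -(mulr0 (b x x)) -yE -[RHS]subr0 -(mulr0 (b x y)) -xE [b y x]polarC.
by ring.
Qed.

Lemma orthogonal_commutator x y z u : \dim {:W} = 4%N ->
  disc q x y != 0 -> disc q z u != 0 -> orthogonal_planes q x y z u ->
  exists c k, [/\ k != 0, c * c = k%:A, even_span c,
    (forall v, e v * c = - (c * e v)) & commutator z u = c * commutator x y].
Proof.
move=> dimW dxy dzu orth_xyzu.
have four_neq0 := four_neq0 two_neq0.
have orth v w : v \in [:: x; y] -> w \in [:: z; u] -> b v w = 0.
  by move=> v_in w_in; apply: orth_xyzu; apply: memv_span.
have [xz xu yz yu] : [/\ b x z = 0, b x u = 0, b y z = 0 & b y u = 0].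
  by split; apply: orth; rewrite !inE eqxx ?orbT.
set a := commutator x y; set c := commutator z u.
have comm0 v w v' : b w v' = 0 -> b v v' = 0 ->
    commutator v w * e v' = e v' * commutator v w.
  move=> wv' vv'; apply/eqP; rewrite -subr_eq0 commutator_contract.
  by rewrite /contract wv' vv' !scale0r subrr scaler0 linear0.
have az : a * e z = e z * a by apply: comm0; rewrite // polarC.
have au : a * e u = e u * a by apply: comm0; rewrite // polarC.
have cx : c * e x = e x * c by apply: comm0; rewrite // polarC.
have cy : c * e y = e y * c by apply: comm0; rewrite // polarC.
have ac : a * c = c * a.
  by apply: commutator_comm.
have dN0 : - (4 * disc q x y) != 0 by rewrite oppr_eq0 mulf_neq0.
have a_sqr : a * a = (- (4 * disc q x y))%:A := commutator_sqr x y.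
have c_sqr : c * c = (- (4 * disc q z u))%:A := commutator_sqr z u.
have [xa ya] : e x * a = - (a * e x) /\ e y * a = - (a * e y).
  by split; [apply: commutator_anti | apply: commutator_antir].
have [zc uc] : e z * c = - (c * e z) /\ e u * c = - (c * e u).
  by split; [apply: commutator_anti | apply: commutator_antir].
have [a_even c_even] : even_span a /\ even_span c.
  by split; apply: even_span_commutator.
clearbody a c.
(* The witness is [c] times the inverse of [a], as [a * a] is the scalar -4 disc(x,y); since [a] and
   [c] commute, its square is the quotient of their squares. *)
exists ((- (4 * disc q x y))^-1 *: (c * a)), (disc q z u / disc q x y); split.
- by rewrite mulf_neq0 ?invr_neq0.
- rewrite -scalerAl -scalerAr !mulrA -[c * a * c]mulrA ac mulrA c_sqr -mulrA.
  rewrite mulr_algl -[a * a]scale1r a_sqr !scalerA; congr (_ *: _).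
  by field; rewrite dxy.
- by apply/even_spanZ/even_spanM.
- move=> v; rewrite -scalerAr -scalerAl -scalerN; congr (_ *: _).
  (* Pairing a relation with each of the four vectors separates the two orthogonal planes, and each
     plane is non-degenerate. By dimension the vectors then form a basis, on which anticommutation
     can be checked. *)
  have free_xyzu : free [:: x; y; z; u].
    have lin_free k0 k1 k2 k3 : k0 *: x + k1 *: y + (k2 *: z + k3 *: u) = 0 ->
        [/\ k0 = 0, k1 = 0, k2 = 0 & k3 = 0].
      move=> k_0.
      have bE w : b w (k0 *: x + k1 *: y) + b w (k2 *: z + k3 *: u) = 0.
        by rewrite -polarDr k_0 polar0r.
      have [||-> ->] := nondegenerate_plane (r := k0) (t := k1) dxy.
      - rewrite -[LHS]addr0 -[RHS](bE x); congr (_ + _).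
        by rewrite polarDr !polarZr xz xu !mulr0 addr0.
      - rewrite -[LHS]addr0 -[RHS](bE y); congr (_ + _).
        by rewrite polarDr !polarZr yz yu !mulr0 addr0.
      have [||-> ->] // := nondegenerate_plane (r := k2) (t := k3) dzu.
      - rewrite -[LHS]add0r -[RHS](bE z); congr (_ + _).
        by rewrite polarDr !polarZr ![b z _]polarC xz yz !mulr0 addr0.
      - rewrite -[LHS]add0r -[RHS](bE u); congr (_ + _).
        by rewrite polarDr !polarZr ![b u _]polarC xu yu !mulr0 addr0.
    apply/(freeP (X := [tuple x; y; z; u])) => l.
    rewrite !big_ord_recl big_ord0 addr0 /= addrA => /lin_free[l0 l1 l2 l3] i.
    by case: i => [[|[|[|[|//]]]] lt_i]; [move: l0|move: l1|move: l2|move: l3];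
      move=> <-; congr l; apply: val_inj.
  have : v \in <<[:: x; y; z; u]>>%VS.
    suff /span_basis -> : basis_of {:W} [:: x; y; z; u] by rewrite memvf.
    by rewrite basisEfree free_xyzu subvf dimW.
  apply: (span_closed (P := fun v => e v * (c * a) = - (c * a * e v)))
    => [|k v1 v2 E1 E2|w].
  - by rewrite linear0 mul0r mulr0 oppr0.
  - rewrite linearP mulrDl mulrDr -scalerAl -scalerAr E1 E2 opprD scalerN //.
  rewrite !inE => /or4P[] /eqP ->.
  - by rewrite mulrA -cx -[c * e x * a]mulrA xa mulrN mulrA.
  - by rewrite mulrA -cy -[c * e y * a]mulrA ya mulrN mulrA.
  - by rewrite mulrA zc mulNr -[c * e z * a]mulrA -az mulrA.
  - by rewrite mulrA uc mulNr -[c * e u * a]mulrA -au mulrA.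
by rewrite -scalerAl -mulrA a_sqr mulr_algr scalerA mulVf ?scale1r.
Qed.

End Center.

Lemma commutator_contract_inj x y x' y' : quad_nondegenerate q ->
  commutator x y = commutator x' y' ->
  forall v, contract q x y v = contract q x' y' v.
Proof.
move=> nd cE v; apply: (scalerI two_neq0); apply: (in_inj nd).
by rewrite -!commutator_contract cE.
Qed.

End CliffordAlgebra.

(** * Inverses and conjugation of commutators *)

Section UnitAlgebra.
Variables (K : fieldType) (W : vectType K) (A : unitAlgType K).
Variable e : {linear W -> A}.
Implicit Types (x y : W) (a c : A).

Lemma sqr_scalar_unit a (k : K) : a * a = k%:A -> k != 0 ->
  a \is a GRing.unit /\ a^-1 = k^-1 *: a.
Proof.
move=> a_sqr k0.
have [aK Ka] : a * (k^-1 *: a) = 1 /\ k^-1 *: a * a = 1.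
  by rewrite -scalerAr -scalerAl a_sqr scalerA mulVf // scale1r.
have a_unit : a \is a GRing.unit by apply/unitrP; exists (k^-1 *: a).
by split=> //; apply: (mulrI a_unit); rewrite divrr.
Qed.

Lemma commutator_conj a x y x' y' : a \is a GRing.unit ->
  a * e x * a^-1 = e x' -> a * e y * a^-1 = e y' ->
  commutator e x' y' = a * commutator e x y * a^-1.
Proof.
move=> a_unit ax ay; rewrite /commutator -ax -ay mulrBr mulrBl.
by rewrite !mulrA !(mulrVK a_unit).
Qed.

(** The scalar [x,y]^2 = -4 disc(x,y) is unchanged by conjugation. *)
Lemma disc_conj (q : quad_form W) a x y x' y' : (2 : K) != 0 ->
  (forall z, e z * e z = (q z)%:A) -> a \is a GRing.unit ->
  a * e x * a^-1 = e x' -> a * e y * a^-1 = e y' -> disc q x' y' = disc q x y.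
Proof.
move=> two_neq0 e_sqr a_unit ax ay.
have four_neq0 := four_neq0 two_neq0.
apply: (mulfI four_neq0); apply: oppr_inj; apply: (@scalar_inj _ A).
rewrite -!(commutator_sqr e_sqr two_neq0) (commutator_conj a_unit ax ay).
rewrite !mulrA (mulrVK a_unit) -[a * _ * _]mulrA (commutator_sqr e_sqr two_neq0).
by rewrite mulr_algr -scalerAl divrr.
Qed.

End UnitAlgebra.

(** * Products of vectors with square zero *)

Section SquareZero.
Variables (K : fieldType) (W : vectType K) (A : algType K).
Variable e : {linear W -> A}.
Hypothesis e_sqr0 : forall x, e x * e x = 0.

Lemma mul_inP k x y z : e (k *: x + y) * e z = k *: (e x * e z) + e y * e z.
Proof. by rewrite linearP mulrDl -scalerAl. Qed.

Lemma mul_inC x y : e x * e y = - (e y * e x).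
Proof.
apply/eqP; rewrite -addr_eq0; apply/eqP; have := e_sqr0 (x + y).
by rewrite linearD mulrDl !mulrDr !e_sqr0 add0r addr0.
Qed.

End SquareZero.

(** * Pure wedges *)

Section Wedge.
Variables (K : fieldType) (W : vectType K) (q : quad_form W).
Implicit Types x y u v w : W.

Local Notation b := (polar q).

(* The minor [b y v * b x w - b x v * b y w] of [x /\ y] is the corner entry of
   a product of two nilpotent matrices depending linearly on [x] and [y]. *)
Definition minor_mx v w x : 'M[K]_4 :=
  \matrix_(i, j) if (i == 0 :> nat) && (j == 1 :> nat) then b x w
    else if (i == 0 :> nat) && (j == 2 :> nat) then b x v
    else if (i == 1 :> nat) && (j == 3 :> nat) then b x v
    else if (i == 2 :> nat) && (j == 3 :> nat) then - b x w else 0.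

Lemma minor_mx_is_linear v w : linear (minor_mx v w).
Proof.
move=> k x y; apply/matrixP => i j; rewrite !mxE !polarDl !polarZl.
by do ![case: ifP => _]; ring.
Qed.

Lemma mul_minor_mx v w x y :
  minor_mx v w x * minor_mx v w y = b (contract q x y v) w *: delta_mx 0 3.
Proof.
apply/matrixP => i j; rewrite !mxE !big_ord_recl big_ord0 !mxE polar_contract.
case: i => [[|[|[|[|//]]]] lt_i]; case: j => [[|[|[|[|//]]]] lt_j] /=; ring.
Qed.

(** The universal property of the exterior algebra sends [wedge x y] to the product of the two
    matrices, whose corner entry is [b (contract q x y v) w]; non-degeneracy then recovers the
    vector. *)
Lemma wedge_contract x y x' y' : quad_nondegenerate q ->
  wedge x y = wedge x' y' -> forall v, contract q x y v = contract q x' y' v.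
Proof.
move=> nd wE v; apply/eqP; rewrite -subr_eq0; apply/eqP/nd => w.
pose f : {linear W -> 'M[K]_4} := HB.pack (minor_mx v w)
  (GRing.isLinear.Build K W 'M[K]_4 _ (minor_mx v w) (minor_mx_is_linear v w)).
have f_sqr z : f z * f z = (zero_quad W z)%:A.
  by rewrite /= mul_minor_mx contractxx polar0l !scale0r.
have [g [_ [_ gM] gf _]] := clifford_universal f_sqr.
have gw u z : g (wedge u z) = minor_mx v w u * minor_mx v w z.
  exact: etrans (gM _ _) (congr2 *%R (gf u) (gf z)).
have : minor_mx v w x * minor_mx v w y = minor_mx v w x' * minor_mx v w y'.
  by rewrite -!gw wE.
rewrite !mul_minor_mx => {gw gf gM g wE}.
move/matrixP/(_ 0 3); rewrite !mxE /= !mulr1 => bE.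
by rewrite polarDl polarNl bE subrr.
Qed.

Lemma wedge_alternating :
  [/\ forall k x y z, wedge (k *: x + y) z = k *: wedge x z + wedge y z,
      forall x y, wedge x y = - wedge y x & forall x, wedge x x = 0].
Proof.
have sqr0 x : clifford_in (zero_quad W) x * clifford_in (zero_quad W) x = 0.
  by rewrite clifford_in_sqr scale0r.
by split=> *; [apply: mul_inP | apply: mul_inC | apply: sqr0].
Qed.

(** Both sides, times 4, equal the mixed minor b(x,x')b(y,y') - b(x,y')b(y,x'), which is symmetric
    in the two pairs. *)
Lemma disc_contract x y x' y' : (2 : K) != 0 ->
  (forall v, contract q x y v = contract q x' y' v) ->
  disc q x y = disc q x' y'.
Proof.
move=> two_neq0 cE.
have four_neq0 := four_neq0 two_neq0.
have discE u v : 4 * disc q u v = b (contract q u v v) u.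
  by rewrite (disc_polar _ two_neq0) polar_contract [b v u]polarC expr2 mulrC.
apply: (mulfI four_neq0); rewrite !discE cE -[in RHS]cE !polar_contract.
rewrite [b y' y]polarC [b x' x]polarC [b x' y]polarC [b y' x]polarC.
by ring.
Qed.

End Wedge.

(** * The map kappa *)

Section Kappa.
Variables (K : fieldType) (W : vectType K) (q : quad_form W).
Hypothesis two_neq0 : (2 : K) != 0.
Hypothesis nd : quad_nondegenerate q.
Hypothesis dimW : \dim {:W} = 4%N.

Local Notation comm := (clifford_comm q).

Let e_sqr := clifford_in_sqr q.
Let four_neq0 := four_neq0 two_neq0.

Lemma clifford_sigma_in x :
  clifford_sigma (clifford_in q x) = - clifford_in q x.
Proof. by have := clifford_sigma_prod q [:: x]; rewrite !big_seq1. Qed.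

(** A total function: [xget] chooses some non-degenerate representing pair, with default (0,0),
    hence value 0, when there is none. [kappa_wedge] shows that the choice does not matter. *)
Definition kappa (w : exterior W) : clifford q :=
  let p := xget (0, 0)
    [set p : W * W | w = wedge p.1 p.2 /\ disc q p.1 p.2 != 0]%classic in
  comm p.1 p.2.

(** The pair witnessing [wedge_nd] may differ from [x], [y], but [disc] depends only on the wedge,
    through [contract]. *)
Lemma wedge_ndP x y : wedge_nd q (wedge x y) <-> disc q x y != 0.
Proof.
split=> [[x' [y' [wE d0]]]|d0]; last first.
  exact: ex_intro _ x (ex_intro _ y (conj erefl d0)).
by rewrite (disc_contract two_neq0 (wedge_contract nd wE)).
Qed.

Lemma comm_contract x y x' y' : disc q x y != 0 ->
  (forall v, contract q x y v = contract q x' y' v) -> comm x y = comm x' y'.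
Proof.
exact: (alternating_contract two_neq0 (commutatorP (clifford_in q))
  (commutatorC (clifford_in q)) (commutatorxx (clifford_in q))).
Qed.

Lemma kappa_wedge x y : disc q x y != 0 -> kappa (wedge x y) = comm x y.
Proof.
move=> d0; pose P : set (W * W) :=
  [set p : W * W | wedge x y = wedge p.1 p.2 /\ disc q p.1 p.2 != 0]%classic.
have [wE _] : P (xget (0, 0) P).
  exact: xgetPex (ex_intro P (x, y) (conj erefl d0)).
exact: esym (comm_contract d0 (wedge_contract nd wE)).
Qed.

Lemma comm_calQ x y : disc q x y != 0 -> calQ q (comm x y).
Proof.
move=> d0.
have dN0 : - (4 * disc q x y) != 0 by rewrite oppr_eq0 mulf_neq0.
have [c_unit cV] := sqr_scalar_unit (commutator_sqr e_sqr two_neq0 x y) dN0.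
have c_even : clifford_even q (comm x y) := even_span_commutator _ x y.
split.
- by split=> //; exact: (eq_ind_r (clifford_even q) (even_spanZ _ c_even) cV).
- exact: (sigma_commutator (clifford_sigmaM (q := q)) clifford_sigma_in).
exists (4 * disc q x y); first by rewrite mulf_neq0.
exact: (norm_commutator e_sqr two_neq0 (clifford_sigmaM (q := q))
  clifford_sigma_in x y).
Qed.

Lemma kappa_bij : set_bij (wedge_nd q) (calQ q) kappa.
Proof.
split.
- move=> w [x [y [-> d0]]]; rewrite kappa_wedge //; exact: comm_calQ.
(* Injectivity: equal commutators give equal [contract], which determines the alternating map
   [wedge]. *)
- move=> w w' /set_mem[x [y [-> d0]]] /set_mem[x' [y' [-> d0']]] kE.
  have cE := etrans (esym (kappa_wedge d0)) (etrans kE (kappa_wedge d0')).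
  have [wedgeP wedgeC wedgexx] := wedge_alternating W.
  apply: (alternating_contract two_neq0 wedgeP wedgeC wedgexx d0).
  exact: (commutator_contract_inj e_sqr two_neq0 nd cE).
move=> a [[a_even _ _] sigma_a [k k0 a_norm]].
have [x [y aE]] := skew_even_commutator e_sqr two_neq0 nd dimW
  (clifford_sigma1 q) (clifford_sigmaM (q := q)) clifford_sigma_in
  a_even sigma_a k0 a_norm.
(* The norm of [a] is both the non-zero scalar [k] and 4 disc(x,y). *)
have d0 : disc q x y != 0.
  apply: contra_neq k0 => d0; apply: (@scalar_inj _ (clifford q)).
  have := norm_commutator e_sqr two_neq0 (clifford_sigmaM (q := q))
    clifford_sigma_in x y.
  by rewrite -aE -[a * _]/(clifford_norm a) a_norm d0 mulr0.
exists (wedge x y); first exact/wedge_ndP.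
by rewrite kappa_wedge.
Qed.

Lemma kappa_equivariant a x y : special_clifford_group q a ->
  wedge_nd q (wedge x y) ->
  wedge_nd q (wedge (vector_Ad a x) (vector_Ad a y)) /\
  kappa (wedge (vector_Ad a x) (vector_Ad a y)) = clifford_Ad a (kappa (wedge x y)).
Proof.
move=> [[_ a_unit _] aP] /wedge_ndP d0.
have AdE v : a * clifford_in q v * a^-1 = clifford_in q (vector_Ad a v).
  exact: (xgetPex 0 (aP v)).
have cE : comm (vector_Ad a x) (vector_Ad a y) = clifford_Ad a (comm x y).
  exact: (commutator_conj a_unit (AdE x) (AdE y)).
have d0' : disc q (vector_Ad a x) (vector_Ad a y) != 0.
  by rewrite (disc_conj two_neq0 e_sqr a_unit (AdE x) (AdE y)).
split; first exact/wedge_ndP.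
have kE := congr1 (clifford_Ad a) (esym (kappa_wedge d0)).
exact (etrans (kappa_wedge d0') (etrans cE kE)).
Qed.

Lemma kappa_orthogonal x y z u : wedge_nd q (wedge x y) ->
  wedge_nd q (wedge z u) -> orthogonal_planes q x y z u ->
  exists c : clifford q, [/\ c != 0, even_center q c, traceless c &
    kappa (wedge z u) = c * kappa (wedge x y)].
Proof.
move=> /wedge_ndP dxy /wedge_ndP dzu orth.
have [c [k [k0 c_sqr c_even cN cE]]] :=
  orthogonal_commutator e_sqr two_neq0 dimW dxy dzu orth.
exists c; split.
- apply: contra_neq k0 => c0; apply: (@scalar_inj _ (clifford q)).
  by rewrite -c_sqr c0 mul0r scale0r.
- split=> [|a a_even]; first exact: c_even.
  exact: (anti_in_even_central cN a_even).
- have dim_gt0 : (0 < \dim {:W})%N by rewrite dimW.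
  exact: (traceless_basis e_sqr two_neq0 nd c_even cN c_sqr k0 dim_gt0).
have kE := congr1 ( *%R c) (esym (kappa_wedge dxy)).
exact (etrans (kappa_wedge dzu) (etrans cE kE)).
Qed.

End Kappa.

(** * Non-degeneracy after extension of scalars *)

Lemma mulmx_delta_row (R : pzSemiRingType) n (u : 'rV[R]_n) j :
  (u *m (delta_mx 0 j : 'rV_n)^T) 0 0 = u 0 j.
Proof. by rewrite trmx_delta -colE mxE. Qed.

(** A kernel vector of the rational Gram matrix would give a vector in the radical of [Q], so that
    matrix is invertible, and it stays invertible under the field embedding of the rationals in
    [K]. *)
Lemma ext_quad_nondegenerate (V : vectType rat) (Q : quad_form V)
    (K : fieldType) : [pchar K] =i pred0 -> quad_nondegenerate Q ->
  quad_nondegenerate (ext_quad K Q).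
Proof.
move=> charK nd.
have ratr_zmod : zmod_morphism (@ratr K).
  move=> r t; rewrite ratrD_char0 // -mulN1r ratrM_char0 //.
  by rewrite -[-1]/((-1)%:~R) ratr_int mulN1r.
have ratr_monoid : monoid_morphism (@ratr K).
  by split; [rewrite -[1]/(1%:~R) ratr_int | apply: ratrM_char0].
pose f : {rmorphism rat -> K} := HB.pack (@ratr K)
  (GRing.isZmodMorphism.Build rat K (@ratr K) ratr_zmod)
  (GRing.isMonoidMorphism.Build rat K (@ratr K) ratr_monoid).
pose G : 'M[rat]_(\dim {:V}) := \matrix_(i, j) (polar Q (vbase i) (vbase j) / 2).
have G_unit : G \in unitmx.
  rewrite -row_free_unit; apply: inj_row_free => v vG.
  pose x := \sum_i v 0 i *: vbase i.
  have x0 : x = 0.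
    apply: nd => y; rewrite [y]vbase_sum polar_sumr big1 // => j _.
    have vGj : \sum_i v 0 i * (polar Q (vbase i) (vbase j) / 2) = 0.
      have := congr1 (fun r : 'rV_ _ => r 0 j) vG; rewrite !mxE => vGj.
      by rewrite -[RHS]vGj; apply: eq_bigr => i _; rewrite mxE.
    rewrite polarZr polarC polar_sumr.
    suff -> : \sum_i polar Q (vbase j) (v 0 i *: vbase i) =
        2 * \sum_i v 0 i * (polar Q (vbase i) (vbase j) / 2).
      by rewrite vGj !mulr0.
    rewrite mulr_sumr; apply: eq_bigr => i _.
    by rewrite polarZr polarC; field.
  apply/rowP => j; rewrite mxE.
  have := congr1 (coord (vbasis {:V}) j) x0; rewrite linear0 linear_sum.
  rewrite (bigD1 j) //= big1 => [|i ij].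
    by rewrite linearZ /= coord_vbase eqxx mulr1 addr0.
  by rewrite linearZ /= coord_vbase eq_sym (negPf ij) mulr0.
have gramE : ext_gram K Q = map_mx f G by apply/matrixP => i j; rewrite !mxE.
have gram_unit : ext_gram K Q \in unitmx by rewrite gramE map_unitmx.
have gramT : (ext_gram K Q)^T = ext_gram K Q.
  by apply/matrixP => i j; rewrite !mxE polarC.
move=> x xP.
have two_neq0 : (2 : K) != 0 by rewrite ((pcharf0P K).1 charK).
have : x *m ext_gram K Q = 0.
  apply/rowP => j; rewrite [RHS]mxE.
  have entry : (x *m ext_gram K Q *m (delta_mx 0 j : 'rV_(_))^T) 0 0 =
      (x *m ext_gram K Q) 0 j.
    exact: mulmx_delta_row.
  have := xP (delta_mx 0 j); rewrite polar_ext.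
  (* By symmetry of the Gram matrix the two terms of [polar_ext] agree, so pairing [x] with a basis
     vector gives twice an entry of [x *m ext_gram K Q]. *)
  have -> (d : 'rV_(_)) : (d *m ext_gram K Q *m x^T) 0 0 =
      (x *m ext_gram K Q *m d^T) 0 0.
    transitivity ((d *m ext_gram K Q *m x^T)^T 0 0); first by rewrite [RHS]mxE.
    by rewrite !trmx_mul trmxK gramT mulmxA.
  rewrite entry.
  move=> /eqP; rewrite -mulr2n -mulr_natl mulf_eq0 (negPf two_neq0).
  by move/eqP.
move/(congr1 (mulmx^~ (invmx (ext_gram K Q)))).
by rewrite mulmxK // mul0mx.
Qed.

Theorem proposition2p7 (V : vectType rat) (Q : quad_form V) (K : fieldType)
    (dimV : \dim {:V} = 4%N) (ndQ : quad_nondegenerate Q)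
    (charK : [pchar K] =i pred0) :
  let VK := extension V K in
  let QK : quad_form VK := ext_quad K Q in
  exists kappa : exterior VK -> clifford QK,
    [/\ forall v1 v2 : VK, wedge_nd QK (wedge v1 v2) ->
          kappa (wedge v1 v2) = clifford_comm QK v1 v2,
        set_bij (wedge_nd QK) (calQ QK) kappa,
        forall (a : clifford QK) (v1 v2 : VK),
          special_clifford_group QK a -> wedge_nd QK (wedge v1 v2) ->
          wedge_nd QK (wedge (vector_Ad a v1) (vector_Ad a v2)) /\
          kappa (wedge (vector_Ad a v1) (vector_Ad a v2)) =
            clifford_Ad a (kappa (wedge v1 v2))
      & forall v1 v2 v3 v4 : VK,
          wedge_nd QK (wedge v1 v2) -> wedge_nd QK (wedge v3 v4) ->
          orthogonal_planes QK v1 v2 v3 v4 ->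
          exists z : clifford QK,
            [/\ z != 0, even_center QK z, traceless z &
              kappa (wedge v3 v4) = z * kappa (wedge v1 v2)]].
Proof.
move=> VK QK.
have two_neq0 : (2 : K) != 0 by rewrite ((pcharf0P K).1 charK).
have nd : quad_nondegenerate QK := ext_quad_nondegenerate charK ndQ.
have dimVK : \dim {:VK} = 4%N by rewrite dimvf dim_matrix mul1r dimV.
exists (kappa QK); split.
- by move=> x y /(wedge_ndP two_neq0 nd); apply: kappa_wedge.
- exact: kappa_bij.
- exact: kappa_equivariant.
- exact: kappa_orthogonal.
Qed.
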